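(* Let $p:\mathbb{R}^n\to\mathbb{R}$ be a homogeneous polynomial of degree $d$ hyperbolic along $e$, and suppose that $\Lambda_+=\Lambda_+(p,e)\subseteq\mathbb{R}^n$ is regular and rank-one generated (ROG) with respect to $p$. Let $A\in\operatorname{Aut}(\Lambda_+)$, let $z\in\Lambda_+$ be an eigenvector of $A$ (at least one exists), and let $F(z)$ be the minimal face of $\Lambda_+$ containing $z$. Then the following hold. (i) $A\in\operatorname{Aut}(F(z))$. (ii) Let $m=\operatorname{mult}(z)$ be the multiplicity of $z$ with respect to $p$, and let $q$ be the restriction of $D_e^mp$ to the subspace $\operatorname{span}F(z)$, so that $q$ is hyperbolic along $z$ and $F(z)=\Lambda_+(q,z)$. If $d-m\ge 4$, then for every $k$ with $1\le k\le d-m-3$, $$A\in\operatorname{Aut}(\Lambda_+^{(k)}(q,z)),$$ where $\Lambda_+^{(k)}(q,z)=\Lambda_+(D_z^kq,z)$ is the $k$-th derivative relaxation of $\Lambda_+(q,z)$ along the direction $z$.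
   Context: Let $V$ be a finite-dimensional real vector space. A homogeneous polynomial $p:V\to\mathbb{R}$ of degree $d$ is hyperbolic along $e\in V$ if $p(e)>0$ and for every $x\in V$ the univariate polynomial $t\mapsto p(x-te)$ has only real roots. Its hyperbolicity cone is the closed convex cone $\Lambda_+(p,e)=\{x\in V\mid \text{all roots of } t\mapsto p(te-x) \text{ are nonnegative}\}$. The eigenvalues of $x$ are the $d$ roots of $t\mapsto p(te-x)$ counted with multiplicity; for $x\in\Lambda_+(p,e)$, $\operatorname{mult}(x)$ is the multiplicity of $0$ as an eigenvalue of $x$ and $\operatorname{rank}(x)=d-\operatorname{mult}(x)$. The directional derivative is $D_e^kp(x)=\frac{d^k}{dt^k}p(x+te)|_{t=0}$ (with $D_e^0p=p$). A closed convex cone $K\subseteq\mathbb{R}^n$ is pointed if $K\cap(-K)=\{0\}$, and regular if it is pointed and $\dim K=n$. A face of $K$ is a nonempty convex cone $F\subseteq K$ such that $x,y\in K$, $x+y\in F$ imply $x,y\in F$; an extreme ray is a face of dimension $1$. For $z\in K$, the minimal face $F(z)$ is the intersection of all faces of $K$ containing $z$; equivalently it is the unique face containing $z$ in its relative interior. A pointed hyperbolicity cone $\Lambda_+=\Lambda_+(p,e)$ is ROG with respect to $p$ (and $e$) if every extreme ray of $\Lambda_+$ is generated by an element of rank $1$ (computed with respect to $p$ and $e$). $\operatorname{Aut}(\Lambda_+)=\{A\in \mathrm{GL}_n(\mathbb{R})\mid A\Lambda_+=\Lambda_+\}$. For a cone $C$ contained in $\operatorname{span}F(z)$ (namely $C=F(z)$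 or $C=\Lambda_+^{(k)}(q,z)$), $A\in\operatorname{Aut}(C)$ means that $A$ maps $\operatorname{span}F(z)$ onto itself and $A C=C$. *)

(* Defs.v *)
From HB Require Import structures.
From mathcomp Require Import all_boot all_order all_algebra.
From mathcomp Require Import all_classical all_reals all_analysis.
From mathcomp Require Import complex.
(* The notations of mpoly clash with those of mathcomp-analysis. *)
From mathcomp Require Import -(notations) mpoly.

Set Implicit Arguments.
Unset Strict Implicit.
Unset Printing Implicit Defensive.

Import Order.TTheory GRing.Theory Num.Theory.

Local Open Scope classical_set_scope.
Local Open Scope ring_scope.

Section PolynomialFunctions.
Variable R : realType.

(* Homogeneous polynomial functions on a finite-dimensional space, in the
   coordinates of a fixed basis. *)
Definition homog_polyfun (V : vectType R) (d : nat) (f : V -> R) : Prop :=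
  exists P : mpoly (\dim {:V}) R,
    P \is ishomog1 d mdeg /\
    forall x, f x = meval (fun i => coord (vbasis {:V}) i x) P.

(* The univariate polynomial t |-> f (u + t v); see line_polyE. *)
Definition line_poly (V : lmodType R) (f : V -> R) (u v : V) : {poly R} :=
  xget 0 [set P : {poly R} | forall t, P.[t] = f (u + t *: v)].

Lemma line_polyE (V : vectType R) (d : nat) (f : V -> R) (u v : V) (t : R) :
  homog_polyfun d f -> (line_poly f u v).[t] = f (u + t *: v).
Proof.
case=> P [_ fE]; rewrite /line_poly.
case: xgetP => [Q _ /(_ t) //|/(_
  (mmap polyC (fun i => (coord (vbasis {:V}) i u)%:P
     + (coord (vbasis {:V}) i v) *: 'X) P))]; case.
move=> s; rewrite fE /meval /mmap horner_sum.
apply: eq_bigr => m _; rewrite hornerM hornerC; congr (_ * _).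
rewrite /mmap1 horner_prod; apply: eq_bigr => i _.
by rewrite horner_exp !hornerE linearD linearZ /= [s * _]mulrC.
Qed.

Definition real_rooted (P : {poly R}) : Prop :=
  forall w : R[i], root (map_poly (real_complex R) P) w -> complex.Im w = 0.

Definition hyperbolic (V : vectType R) (d : nat) (p : V -> R) (e : V) : Prop :=
  [/\ homog_polyfun d p, 0 < p e
    & forall x, real_rooted (line_poly p x (- e))].

(* For p hyperbolic along e all roots of t |-> p (t e - x) are real, so the
   real roots are all of them. *)
Definition hypcone (V : lmodType R) (p : V -> R) (e : V) : set V :=
  [set x | forall t : R, p (t *: e - x) = 0 -> 0 <= t].

Definition hypmult (V : lmodType R) (p : V -> R) (e x : V) : nat :=
  mup 0 (line_poly p (- x) e).

Definition hyprank (V : lmodType R) (d : nat) (p : V -> R) (e x : V) : nat :=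
  (d - hypmult p e x)%N.

Definition dirderiv (V : lmodType R) (e : V) (k : nat) (p : V -> R) : V -> R :=
  fun x => derive1n k (fun t : R => p (x + t *: e)) 0.

End PolynomialFunctions.

Section Cones.
Variable R : realType.

Definition convex_cone (V : lmodType R) (C : set V) : Prop :=
  forall (a b : R) (x y : V),
    0 <= a -> 0 <= b -> C x -> C y -> C (a *: x + b *: y).

Definition pointed_cone (V : lmodType R) (K : set V) : Prop :=
  K `&` [set x | K (- x)] = [set 0].

(* The linear span of a set, as the smallest subspace containing it;
   see vspanP. *)
Definition vspan (V : vectType R) (C : set V) : {vspace V} :=
  xget 0%VS [set U : {vspace V} | C `<=` [set x | x \in U] /\
    forall W : {vspace V}, C `<=` [set x | x \in W] -> (U <= W)%VS].

Lemma vspanP (V : vectType R) (C : set V) :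
  C `<=` [set x | x \in vspan C] /\
  forall W : {vspace V}, C `<=` [set x | x \in W] -> (vspan C <= W)%VS.
Proof.
rewrite /vspan; case: xgetP => [U _ //|noU]; exfalso.
suff minU : forall n (U : {vspace V}), (\dim U <= n)%N ->
    C `<=` [set x | x \in U] -> exists U0 : {vspace V},
    C `<=` [set x | x \in U0] /\
    forall W : {vspace V}, C `<=` [set x | x \in W] -> (U0 <= W)%VS.
  have [|U0 /noU//] := minU _ fullv (leqnn _).
  by move=> x _ /=; rewrite memvf.
elim=> [|n IHn] U dU CU.
  exists U; split=> // W _; move: dU.
  by rewrite leqn0 dimv_eq0 => /eqP ->; exact: sub0v.
have [minimal|] := pselect (forall W : {vspace V},
    C `<=` [set x | x \in W] -> (U <= W)%VS); first by exists U.
move=> /existsNP[W /not_implyP[CW /negP nUW]].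
apply: (IHn (U :&: W)%VS); last first.
  by move=> x Cx /=; rewrite memv_cap CU // CW.
rewrite -ltnS (leq_trans _ dU) // ltnNge.
apply: contra nUW => dUW; apply/capv_idPl/eqP.
by rewrite eqEdim capvSl.
Qed.

Definition regular_cone (V : vectType R) (K : set V) : Prop :=
  pointed_cone K /\ \dim (vspan K) = \dim {:V}.

Definition is_face (V : lmodType R) (K F : set V) : Prop :=
  [/\ F !=set0, convex_cone F, F `<=` K
    & forall x y, K x -> K y -> F (x + y) -> F x /\ F y].

Definition extreme_ray (V : vectType R) (K F : set V) : Prop :=
  is_face K F /\ \dim (vspan F) = 1%N.

Definition min_face (V : lmodType R) (K : set V) (z : V) : set V :=
  \bigcap_(F in [set F | is_face K F /\ F z]) F.

Definition ROG (V : vectType R) (d : nat) (p : V -> R) (e : V) : Prop :=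
  pointed_cone (hypcone p e) /\
  forall F, extreme_ray (hypcone p e) F ->
    exists x, [/\ hypcone p e x, hyprank d p e x = 1%N
                & F = [set a *: x | a in [set a : R | 0 <= a]]].

Definition cone_aut (n : nat) (K : set 'cV[R]_n) (A : 'M[R]_n) : Prop :=
  A \in unitmx /\ [set A *m x | x in K] = K.

Definition cone_aut_in (n : nat) (L : {vspace 'cV[R]_n}) (C : set 'cV[R]_n)
    (A : 'M[R]_n) : Prop :=
  [set A *m x | x in [set x | x \in L]] = [set x | x \in L] /\
  [set A *m x | x in C] = C.

Definition eigenvector (n : nat) (A : 'M[R]_n) (z : 'cV[R]_n) : Prop :=
  z != 0 /\ exists a : R, A *m z = a *: z.

End Cones.

(* Main.v *)
Require Import Defs.
From HB Require Import structures.
From mathcomp Require Import all_boot all_order all_algebra.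
From mathcomp Require Import all_classical all_reals all_analysis.
From mathcomp Require Import complex polyrcf zify ring lra.
From mathcomp Require Import -(notations) mpoly.

Set Implicit Arguments.
Unset Strict Implicit.
Unset Printing Implicit Defensive.

Import Order.TTheory GRing.Theory Num.Theory.

Local Open Scope classical_set_scope.
Local Open Scope ring_scope.

(** Why the theorem is true.

    The heart of the matter is a rigidity property. Let q be hyperbolic along e
    with pointed cone Q, let I be the interior of Q, and suppose that q is
    affine along every line directed by an extremal vector of Q. For y in I and
    x extremal, the affine function s |-> q (y + s x) has positive slope, so it
    has exactly one zero, and this zero is the parameter at which the line
    leaves Q: it depends on Q only. If a linear map B preserves Q, then q (B _)
    has the same zero on this line, so the ratio q (B y) / q y does not change
    when an extremal vector is added to y (extremal_ratio). Every vector of Q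
    is a sum of extremal vectors (cone_extremal_sum), and two points y, y' of I
    have the common successor y + y', so the ratio is a constant kappa
    (pullback_proportional). If moreover B e = a e, differentiation along e
    gives D_e^k q (B y) = kappa a^-k D_e^k q (y), and B preserves the cone of
    D_e^k q (derivative_cone_invariant).

    This is applied to the restriction q of D_e^m p to span F(z), with
    direction z. The ROG hypothesis enters through hyprank1_affine: p is affine
    along a vector of rank one, and then so is D_e^m p. The equality of F(z)
    with the cone of q is read off the signs of coefficients: x lies in the
    cone of p if and only if t |-> p (x + t e) has nonnegative coefficients,
    and on span F(z) the first m of them vanish (faceE).

    These arguments use the theory of Garding: p is hyperbolic along every c in
    the interior of its cone (hyperbolic_int), the interior is convex
    (hypintD), and neither it nor its closure depends on the direction used to
    define it (hypint_dirE, hypcone_dirE). Both facts are obtained by deforming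
    complex polynomials of constant degree: as long as no root is real, roots
    stay in the open half-plane where they start (half_plane_homotopy).

    Finally, A has an eigenvector in the cone by a Perron-Frobenius theorem
    (perron_frobenius). Its proof follows the polynomial curve
    chi(mu) adj (mu - A) e, with chi the characteristic polynomial, down to the
    infimum r of the mu for which the resolvent is positive; the first
    nonvanishing Taylor coefficient of the curve at r is an eigenvector. *)

(** * Deformation of complex polynomials *)

Section UnivariatePolynomials.
Variable R : realType.
Implicit Types (P Q : {poly R}).

Lemma poly_ext (F : numFieldType) (P Q : {poly F}) :
  (forall t, P.[t] = Q.[t]) -> P = Q.
Proof.
move=> PQ; apply/eqP; rewrite -subr_eq0; apply/negPn/negP => nz.
have /(max_poly_roots nz) : all (root (P - Q)) [seq i%:R | i <- iota 0 (size (P - Q))].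
  by apply/allP => t _; rewrite rootE !hornerE PQ subrr.
rewrite map_inj_uniq ?iota_uniq ?size_map ?size_iota ?ltnn; last first.
  by move=> i j /eqP; rewrite eqr_nat => /eqP.
by move/(_ isT).
Qed.

Lemma poly_ext_gt P Q (a : R) :
  (forall t, a < t -> P.[t] = Q.[t]) -> P = Q.
Proof.
move=> PQ; apply/eqP; rewrite -subr_eq0; apply/negPn/negP => nz.
have /(max_poly_roots nz) :
    all (root (P - Q)) [seq a + i.+1%:R | i <- iota 0 (size (P - Q))].
  apply/allP => t /mapP[i _ ->].
  by rewrite rootE !hornerE PQ ?subrr // ltrDl ltr0n.
rewrite map_inj_uniq ?iota_uniq ?size_map ?size_iota ?ltnn; last first.
  by move=> i j /addrI /eqP; rewrite eqr_nat eqSS => /eqP.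
by move/(_ isT).
Qed.

Lemma poly_ge0_closed P (a b : R) : a < b ->
  (forall t, a < t < b -> 0 <= P.[t]) -> 0 <= P.[a].
Proof.
move=> ab P0; rewrite leNgt; apply/negP => Pa.
have [|r r0 Pr] := @poly_cont R a P (- P.[a]); first by rewrite oppr_gt0.
have s0 : 0 < Num.min (r / 2) ((b - a) / 2).
  by rewrite lt_min !divr_gt0 // subr_gt0.
set s := Num.min _ _ in s0.
have sr : s <= r / 2 by rewrite ge_min lexx.
have sb : s <= (b - a) / 2 by rewrite ge_min lexx orbT.
have := P0 (a + s); have := Pr (a + s).
rewrite [a + s]addrC addrK gtr0_norm // [s + a]addrC => /(_ _)/ltr_normlW H1 H2.
have : s < r by lra.
move/H1 => {}H1; have : 0 <= P.[a + s] by apply: H2; apply/andP; split; lra.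
lra.
Qed.

(** The unit interval is connected: look at the supremum of the points where
    P holds. *)
Lemma real_clopen (P : R -> Prop) :
  (forall a, 0 <= a <= 1 -> P a ->
     exists2 r, 0 < r & forall b, 0 <= b <= 1 -> `|b - a| < r -> P b) ->
  (forall a, 0 <= a <= 1 -> ~ P a ->
     exists2 r, 0 < r & forall b, 0 <= b <= 1 -> `|b - a| < r -> ~ P b) ->
  P 0 -> P 1.
Proof.
move=> op cl P0.
pose S := [set a : R | 0 <= a <= 1 /\ P a].
have S0 : S 0 by split=> //; rewrite lexx ler01.
have hS : has_sup S by split; [exists 0 | exists 1 => a [/andP[]]].
have s0 : 0 <= sup S by apply: ub_le_sup => //; case: hS.
have s1 : sup S <= 1 by apply: ge_sup => [|a [/andP[]]//]; exists 0.
have s01 : 0 <= sup S <= 1 by rewrite s0.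
have [Ps|nPs] := pselect (P (sup S)).
  move: s1; rewrite le_eqVlt => /orP[/eqP <- //|slt].
  have [r r0 Pr] := op _ s01 Ps.
  pose b := sup S + Num.min (r / 2) (1 - sup S).
  have m0 : 0 < Num.min (r / 2) (1 - sup S).
    by rewrite lt_min divr_gt0 // subr_gt0.
  have mr : Num.min (r / 2) (1 - sup S) <= r / 2 by rewrite ge_min lexx.
  have m1 : Num.min (r / 2) (1 - sup S) <= 1 - sup S by rewrite ge_min lexx orbT.
  have b01 : 0 <= b <= 1 by rewrite /b; apply/andP; split; lra.
  have Sb : S b.
    by split=> //; apply: Pr => //; rewrite /b addrAC subrr add0r gtr0_norm //; lra.
  have : b <= sup S by apply: ub_le_sup => //; case: hS.
  rewrite /b; lra.
have [r r0 Pr] := cl _ s01 nPs.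
have [b [b01 Pb] sb] := sup_adherent r0 hS.
have bs : b <= sup S by apply: ub_le_sup => //; case: hS.
exfalso; apply: (Pr b b01 _ Pb).
by rewrite ler0_norm; lra.
Qed.

End UnivariatePolynomials.

Section HalfPlaneHomotopy.
Variable R : realType.
Local Notation C := R[i].
Local Notation nrm := (@ComplexField.Normc.normc R).

Lemma nrmD (x y : C) : nrm (x + y) <= nrm x + nrm y.
Proof. exact: le_normcD. Qed.
Lemma nrmM (x y : C) : nrm (x * y) = nrm x * nrm y.
Proof. exact: ComplexField.Normc.normcM. Qed.
Lemma nrm_ge0 (x : C) : 0 <= nrm x.
Proof. by case: x => a b /=; apply: sqrtr_ge0. Qed.
Lemma nrmN (x : C) : nrm (- x) = nrm x.
Proof. exact: normcN. Qed.
Lemma nrm1 : nrm 1 = 1.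
Proof. exact: ComplexField.Normc.normc1. Qed.
Lemma nrmX (x : C) k : nrm (x ^+ k) = nrm x ^+ k.
Proof. by elim: k => [|k IH]; rewrite ?expr0 ?nrm1 // !exprS nrmM IH. Qed.
Lemma nrm_gt0 (x : C) : x != 0 -> 0 < nrm x.
Proof.
move=> x0; rewrite lt_def nrm_ge0 andbT; apply: contra x0 => /eqP.
by move/ComplexField.Normc.eq0_normc ->.
Qed.
Lemma nrmR (r : R) : nrm r%:C%C = `|r|.
Proof. by rewrite /= expr0n /= addr0 sqrtr_sqr. Qed.
Lemma nrm_Im (x : C) : `|complex.Im x| <= nrm x.
Proof.
by case: x => a b /=; rewrite -sqrtr_sqr ler_wsqrtr // lerDr sqr_ge0.
Qed.
Lemma nrm_sum (I : Type) (s : seq I) (F : I -> C) :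
  nrm (\sum_(i <- s) F i) <= \sum_(i <- s) nrm (F i).
Proof.
elim/big_ind2: _ => [|x1 x2 y1 y2 h1 h2|//].
  by rewrite ComplexField.Normc.normc0.
by apply: le_trans (nrmD _ _) _; apply: lerD.
Qed.
Lemma nrm_prod (I : Type) (s : seq I) (F : I -> C) :
  nrm (\prod_(i <- s) F i) = \prod_(i <- s) nrm (F i).
Proof. by elim/big_rec2: _ => [|i x y _ <-]; rewrite ?nrm1 ?nrmM. Qed.

Lemma poly_nrm_cont (P : {poly C}) (a r : R) : 0 < r ->
  exists2 s, 0 < s & forall b : R, `|b - a| < s ->
    nrm (P.[b%:C%C] - P.[a%:C%C]) < r.
Proof.
elim/poly_ind: P r => [|P c IH] r r0.
  exists 1 => // b _; rewrite !horner0 subrr.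
  by rewrite ComplexField.Normc.normc0.
pose M := nrm P.[a%:C%C] + 1.
have M0 : 0 < M by rewrite ltr_wpDl ?nrm_ge0.
pose N := `|a| + 1; have N0 : 0 < N by rewrite ltr_wpDl.
have [|s s0 Ps] := IH (r / (2 * N)); first by rewrite divr_gt0 ?mulr_gt0.
exists (Num.min s (Num.min 1 (r / (2 * M)))).
  by rewrite !lt_min s0 ltr01 divr_gt0 // mulr_gt0.
move=> b; rewrite !lt_min => /andP[bs /andP[b1 bM]].
rewrite !hornerMXaddC.
have -> : P.[b%:C%C] * b%:C%C + c - (P.[a%:C%C] * a%:C%C + c) =
    (P.[b%:C%C] - P.[a%:C%C]) * b%:C%C + P.[a%:C%C] * (b - a)%:C%C.
  by rewrite rmorphB /=; ring.
apply: le_lt_trans (nrmD _ _) _; rewrite !nrmM !nrmR.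
have bN : `|b| <= N.
  rewrite /N; have -> : b = a + (b - a) by ring.
  by apply: le_trans (ler_normD _ _) _; rewrite lerD2l ltW.
have h1 : nrm (P.[b%:C%C] - P.[a%:C%C]) * `|b| <= r / (2 * N) * N.
  by apply: ler_pM => //; [exact: nrm_ge0 | exact/ltW/Ps].
have h2 : nrm P.[a%:C%C] * `|b - a| < M * (r / (2 * M)).
  apply: (@le_lt_trans _ _ (M * `|b - a|)); last by rewrite ltr_pM2l.
  by rewrite ler_wpM2r // lerDl.
have e1 : r / (2 * N) * N = r / 2 by field; rewrite gt_eqF.
have e2 : M * (r / (2 * M)) = r / 2 by field; rewrite gt_eqF.
rewrite e1 in h1; rewrite e2 in h2; lra.
Qed.

(** One s serves all the coefficients; this is what controls a root of modulus
    not bounded in advance. *)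
Lemma coef_nrm_cont (G : {poly {poly C}}) n (a r : R) : 0 < r ->
  exists2 s, 0 < s & forall b : R, `|b - a| < s -> forall k, (k < n)%N ->
    nrm ((G`_k).[b%:C%C] - (G`_k).[a%:C%C]) < r.
Proof.
move=> r0; elim: n => [|n [s s0 IH]]; first by exists 1.
have [s' s'0 H] := poly_nrm_cont G`_n a r0.
exists (Num.min s s'); first by rewrite lt_min s0.
move=> b; rewrite lt_min => /andP[bs bs'] k; rewrite ltnS leq_eqVlt.
by case/orP => [/eqP ->|]; [exact: H | exact: IH].
Qed.

Variables (G : {poly {poly C}}) (d : nat) (l : C).
Hypotheses (l0 : l != 0) (Gd : G`_d = l%:P) (sG : (size G <= d.+1)%N).

Let F (a : R) : {poly C} := map_poly (horner_eval a%:C%C) G.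

Let FE a w : (F a).[w] = \sum_(k < d.+1) (G`_k).[a%:C%C] * w ^+ k.
Proof.
rewrite (@horner_coef_wide _ d.+1).
  by apply: eq_bigr => k _; rewrite coef_map.
by rewrite (leq_trans _ sG) // size_poly.
Qed.

Let Fw a w : (F a).[w] = (G.[w%:P]).[a%:C%C].
Proof.
rewrite FE (horner_coef_wide _ sG) horner_sum; apply: eq_bigr => k _.
by rewrite !hornerE.
Qed.

Let sF a : size (F a) = d.+1.
Proof.
apply/eqP; rewrite eqn_leq (leq_trans (size_poly _ _) sG) /=.
apply: contraNltn l0 => /leq_sizeP/(_ d (leqnn d)).
by rewrite coef_map Gd /= /horner_eval hornerC => ->.
Qed.

Let F_split a : {rs : d.-tuple C | F a = l *: \prod_(w <- rs) ('X - w%:P)}.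
Proof.
have [rs Frs] := closed_field_poly_normal (F a).
have ld : lead_coef (F a) = l.
  by rewrite lead_coefE sF coef_map Gd /= /horner_eval hornerC.
have srs : size rs == d.
  by rewrite -eqSS -(sF a) Frs ld size_scale // size_prod_XsubC.
by exists (Tuple srs); rewrite {1}Frs ld.
Qed.

Let below a := forall w, root (F a) w -> complex.Im w < 0.

Let rt a (rs : d.-tuple C) w : F a = l *: \prod_(w <- rs) ('X - w%:P) ->
  w \in (rs : seq C) -> root (F a) w.
Proof.
move=> -> wr; rewrite rootE hornerZ mulf_eq0; apply/orP; right.
by rewrite -rootE root_prod_XsubC.
Qed.

Let FN a (rs : d.-tuple C) w : F a = l *: \prod_(w <- rs) ('X - w%:P) ->
  nrm (F a).[w] = nrm l * \prod_(u <- rs) nrm (w - u).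
Proof.
move=> ->; rewrite hornerZ horner_prod nrmM nrm_prod; congr (_ * _).
by apply: eq_bigr => u _; rewrite !hornerE.
Qed.

Let far_root (u : C) : complex.Im u < 0 ->
  exists2 k : R, 0 < k & forall w, 0 <= complex.Im w ->
    k * (1 + nrm w) <= nrm (w - u).
Proof.
move=> u0; set h := - complex.Im u; have h0 : 0 < h by rewrite /h; lra.
have K0 : 0 < (1 + nrm u) / h + 1.
  by rewrite addr_gt0 // divr_gt0 // ltr_pwDl // nrm_ge0.
exists ((1 + nrm u) / h + 1)^-1; first by rewrite invr_gt0.
move=> w w0; rewrite ler_pdivrMl //.
have hw : h <= nrm (w - u).
  apply: le_trans (nrm_Im _); case: w u @h u0 h0 K0 w0 => [wr wi] [ur ui] /=.
  by move=> *; rewrite ger0_norm; lra.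
have hww : nrm w <= nrm (w - u) + nrm u.
  by rewrite -{1}(subrK u w); apply: nrmD.
have : 1 + nrm u <= (1 + nrm u) / h * nrm (w - u).
  rewrite mulrAC ler_pdivlMr // ler_wpM2l //.
  by rewrite addr_ge0 // nrm_ge0.
lra.
Qed.

Let far_roots (rs : seq C) : (forall u, u \in rs -> complex.Im u < 0) ->
  exists2 k : R, 0 < k & forall w, 0 <= complex.Im w ->
    k * (1 + nrm w) ^+ size rs <= \prod_(u <- rs) nrm (w - u).
Proof.
elim: rs => [|u rs IH] H.
  by exists 1 => // w _; rewrite big_nil expr0 mulr1.
have [|k k0 Hk] := IH; first by move=> v vr; apply: H; rewrite inE vr orbT.
have [k' k'0 Hk'] := far_root (H u (mem_head _ _)).
exists (k' * k); first exact: mulr_gt0.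
move=> w w0; rewrite big_cons exprS mulrACA ler_pM ?Hk ?Hk' //.
  by rewrite mulr_ge0 ?addr_ge0 ?nrm_ge0 ?ltW.
by rewrite mulr_ge0 ?exprn_ge0 ?addr_ge0 ?nrm_ge0 ?ltW.
Qed.

Hypothesis noreal : forall a s : R, 0 <= a <= 1 ->
  (G.[(s%:C%C)%:P]).[a%:C%C] != 0.

(** Both the parameters a for which all roots lie in the lower half-plane and
    the other parameters form open sets. A root w with positive imaginary part persists:
    if all roots of F b were below the axis, |F b w| would be at least
    |l| (Im w)^d, whereas F b w is close to F a w = 0. Conversely, if all roots
    of F a are below the axis, |F a w| is at least a constant times
    (1 + |w|)^d on the closed upper half-plane, and this dominates the change
    in F b w, coefficient by coefficient. *)
Lemma half_plane_homotopy :
  (forall w : C, (G.[w%:P]).[0] = 0 -> complex.Im w < 0) ->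
  (forall w : C, (G.[w%:P]).[1] = 0 -> complex.Im w < 0).
Proof.
suff: below 0 -> below 1.
  move=> H H0 w /eqP Hw; apply: H => [w'|]; last by rewrite rootE Fw.
  by rewrite rootE Fw => /eqP; apply: H0.
apply: real_clopen => a a01.
- move=> ga; have [rs Fa] := F_split a.
  have [k k0 Hk] := far_roots (fun u ur => ga u (rt Fa ur)).
  have lk0 : 0 < nrm l * k / d.+1%:R by rewrite divr_gt0 ?mulr_gt0 ?nrm_gt0.
  have [s s0 Hs] := coef_nrm_cont G d.+1 a lk0.
  exists s => // b b01 bs w Fbw; rewrite ltNge; apply/negP => w0.
  have := Hk w w0; rewrite size_tuple -(ler_pM2l (nrm_gt0 l0)) -(FN w Fa).
  apply/negP; rewrite -ltNge.
  have -> : (F a).[w] = - ((F b).[w] - (F a).[w]).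
    by move: Fbw; rewrite rootE => /eqP ->; rewrite sub0r opprK.
  rewrite nrmN !FE -sumrB.
  apply: le_lt_trans (nrm_sum _ _) _.
  have W1 : 1 <= 1 + nrm w by rewrite lerDl nrm_ge0.
  apply: (@lt_le_trans _ _ (\sum_(i < d.+1) (nrm l * k / d.+1%:R) * (1 + nrm w) ^+ d)).
    apply: ltr_sum => [|i _]; first by apply/hasP; exists ord0; rewrite ?mem_index_enum.
    rewrite -mulrBl nrmM nrmX.
    apply: (@le_lt_trans _ _ (nrm ((G`_i).[b%:C%C] - (G`_i).[a%:C%C]) * (1 + nrm w) ^+ d)).
      rewrite ler_wpM2l ?nrm_ge0 //.
      apply: (@le_trans _ _ ((1 + nrm w) ^+ i)).
        by rewrite lerXn2r ?nnegrE ?nrm_ge0 ?addr_ge0 ?nrm_ge0 // lerDr.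
      by rewrite ler_weXn2l // -ltnS.
    by rewrite ltr_pM2r ?exprn_gt0 ?(lt_le_trans ltr01) // Hs.
  rewrite sumr_const card_ord -mulrnAl -[X in X * _ <= _]mulr_natr divfK ?pnatr_eq0 //.
  by rewrite mulrA.
- move/existsNP => [w /not_implyP[Faw /negP]]; rewrite -leNgt => w0.
  have {}w0 : 0 < complex.Im w.
    rewrite lt_def w0 andbT; apply/eqP => w00.
    have ww : w = (complex.Re w)%:C%C by case: w w00 {w0 Faw} => ? ? /= ->.
    by move: Faw; rewrite rootE ww Fw (negbTE (noreal _ _)).
  have e0 : 0 < nrm l * complex.Im w ^+ d by rewrite mulr_gt0 ?nrm_gt0 ?exprn_gt0.
  have [s s0 Hs] := poly_nrm_cont (G.[w%:P]) a e0.
  exists s => // b b01 bs gb; have := Hs b bs; rewrite -!Fw.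
  move: Faw; rewrite rootE => /eqP ->; rewrite subr0.
  have [rs Fb] := F_split b; rewrite (FN w Fb) ltr_pM2l ?nrm_gt0 //.
  apply/negP; rewrite -leNgt.
  have -> : complex.Im w ^+ d = \prod_(u <- rs) complex.Im w.
    by rewrite big_const_seq count_predT size_tuple -Monoid.iteropE.
  rewrite !big_seq; apply: ler_prod => u ur; rewrite (ltW w0) /=.
  apply: le_trans (nrm_Im _); have := gb _ (rt Fb ur).
  case: (w) (u) w0 => [? wi] [? ui] /= w0 u0; rewrite ger0_norm; lra.
Qed.

End HalfPlaneHomotopy.

(** * Substitution in homogeneous polynomials *)

Section PolynomialSubstitution.
Variables (n : nat) (K : comNzRingType).

(** All evaluations below (on vectors, on lines, at complex points) are images
    of one polynomial under ring morphisms, and are compared by this lemma. *)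
Lemma mmap_rmorph (A B : comNzRingType) (g : {rmorphism A -> B})
    (f : K -> A) (h : 'I_n -> A) (P : mpoly n K) :
  g (mmap f h P) = mmap (g \o f) (g \o h) P.
Proof.
rewrite /mmap rmorph_sum; apply: eq_bigr => m _; rewrite rmorphM /=.
by congr (_ * _); rewrite /mmap1 rmorph_prod; apply: eq_bigr => i _; rewrite rmorphXn.
Qed.

Lemma eq_mmap (A : comNzRingType) (f f' : K -> A) (h h' : 'I_n -> A)
    (P : mpoly n K) : f =1 f' -> h =1 h' -> mmap f h P = mmap f' h' P.
Proof.
move=> ff hh; rewrite /mmap; apply: eq_bigr => m _; rewrite ff; congr (_ * _).
by rewrite /mmap1; apply: eq_bigr => i _; rewrite hh.
Qed.

Variables (d : nat) (P : mpoly n K).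
Hypothesis homP : P \is ishomog1 d mdeg.

Lemma mmap_homog (A : comNzRingType) (f : K -> A) (h : 'I_n -> A) (c : A) :
  mmap f (fun i => c * h i) P = c ^+ d * mmap f h P.
Proof.
rewrite /mmap big_distrr /= !big_seq; apply: eq_bigr => m mP.
rewrite mulrCA; congr (_ * _); rewrite /mmap1.
have <- : mdeg m = d by apply: (dhomogP _ _ _ homP).
rewrite mdegE -prodrXr -big_split /=; apply: eq_bigr => i _.
by rewrite exprMn.
Qed.

(** Constancy of the leading coefficient along a family of parallel lines is
    what half_plane_homotopy requires. *)
Lemma mmap_line_lead (A : comNzRingType) (f : K -> A) (u : 'I_n -> A)
    (v : 'I_n -> A) :
  let L := mmap (polyC \o f) (fun i => (u i)%:P + (v i)%:P * 'X) P in
  (size L <= d.+1)%N /\ L`_d = mmap f v P.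
Proof.
pose ok k (Q : {poly A}) c := (size Q <= k.+1)%N /\ Q`_k = c.
have okM k1 Q1 c1 k2 Q2 c2 : ok k1 Q1 c1 -> ok k2 Q2 c2 ->
    ok (k1 + k2)%N (Q1 * Q2) (c1 * c2).
  move=> [s1 <-] [s2 <-]; split.
    by apply: leq_trans (size_polyMleq _ _) _; lia.
  rewrite coefM (bigD1 (inord k1)) //= inordK ?ltnS ?leq_addr // addKn.
  rewrite big1 ?addr0 // => j jk.
  have {}jk : (j : nat) != k1.
    by apply: contraNneq jk => jk1; apply/eqP/val_inj; rewrite /= inordK ?ltnS ?leq_addr.
  have [jlt|jgt|/eqP] := ltngtP j k1; last by rewrite (negbTE jk).
    rewrite (_ : Q2`_(k1 + k2 - j) = 0) ?mulr0 // nth_default //.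
    by apply: leq_trans s2 _; lia.
  by rewrite (_ : Q1`_j = 0) ?mul0r // nth_default // (leq_trans s1).
have ok0 (c : A) : ok 0%N c%:P c.
  by split; rewrite ?coefC // size_polyC; case: (c != 0).
have okh i : ok 1%N ((u i)%:P + (v i)%:P * 'X) (v i).
  split; last by rewrite coefD coefC add0r coefMX coefC.
  by apply/leq_sizeP => -[|[|j]] // _; rewrite coefD coefC coefMX coefC add0r.
have okX i k : ok k (((u i)%:P + (v i)%:P * 'X) ^+ k) (v i ^+ k).
  elim: k => [|k IH]; first exact: ok0.
  by rewrite !exprS; apply: (okM 1%N _ _ k).
move=> L; rewrite -/(ok d L _) /L /mmap.
have ok_sum (s : seq (multinom n)) : {subset s <= msupp P} ->
    ok d (\sum_(m <- s) (polyC \o f) (mcoeff m P) *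
           mmap1 (fun i => (u i)%:P + (v i)%:P * 'X) m)
         (\sum_(m <- s) f (mcoeff m P) * mmap1 v m).
  elim: s => [|m s IH] sP; first by split; rewrite !big_nil ?coef0 // size_poly0.
  have [|s1 c1] := IH; first by move=> x xs; apply: sP; rewrite inE xs orbT.
  have [s2 c2] : ok d ((polyC \o f) (mcoeff m P) *
     mmap1 (fun i => (u i)%:P + (v i)%:P * 'X) m) (f (mcoeff m P) * mmap1 v m).
    have <- : mdeg m = d by apply: (dhomogP _ _ _ homP); rewrite sP ?mem_head.
    apply: (okM 0%N _ _ (mdeg m)) => //; first exact: ok0.
    rewrite mdegE /mmap1; elim/big_ind3: _ => [|x1 x2 x3 y1 y2 y3|i _].
    - exact: ok0.
    - exact: okM.
    - exact: okX.
  split; rewrite !big_cons.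
    by apply: leq_trans (size_polyD _ _) _; rewrite geq_max s2.
  by rewrite coefD c1 c2.
exact: ok_sum.
Qed.

End PolynomialSubstitution.

(** * Complexification and eigenvalues *)

(** The interior of the cone of p. Its elements are those x all of whose
    eigenvalues are positive; stating this as the absence of nonnegative roots
    of t |-> p (x + t e) avoids any reference to the eigenvalues. *)
Definition hypint (R : realType) (V : lmodType R) (p : V -> R) (e : V) : set V :=
  [set x | forall t : R, 0 <= t -> p (x + t *: e) != 0].

Section Complexification.
Variables (R : realType) (V : vectType R) (d : nat) (p : V -> R).
Local Notation C := R[i].
Local Notation N := (\dim {:V}).
Hypothesis hp : homog_polyfun d p.

Let P : mpoly N R := projT1 (cid hp).
Let homP : P \is ishomog1 d mdeg.
Proof. by case: (projT2 (cid hp)). Qed.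
Let pE x : p x = meval (fun i => coord (vbasis {:V}) i x) P.
Proof. by case: (projT2 (cid hp)). Qed.

(** A complex vector is represented by its complex coordinates; cx embeds the
    real vectors. *)
Definition cx (x : V) : 'I_N -> C := fun i => (coord (vbasis {:V}) i x)%:C%C.
(** The extension of p to complex vectors. *)
Definition pC (h : 'I_N -> C) : C := mmap (real_complex R) h P.

Lemma eq_pC h h' : h =1 h' -> pC h = pC h'.
Proof. by move=> hh; apply: eq_mmap. Qed.

Lemma pCZ c h : pC (fun i => c * h i) = c ^+ d * pC h.
Proof. exact: mmap_homog. Qed.

Lemma pC_real x : pC (cx x) = (p x)%:C%C.
Proof. by rewrite pE /meval (mmap_rmorph (real_complex R)); apply: eq_mmap. Qed.

Lemma pC_line (h0 h1 k : 'I_N -> C) : exists G : {poly {poly C}},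
  [/\ (size G <= d.+1)%N, G`_d = (pC k)%:P
    & forall a w : C, (G.[w%:P]).[a] = pC (fun i => h0 i + a * h1 i + w * k i)].
Proof.
have [s c] := mmap_line_lead homP (polyC \o real_complex R)
   (fun i => (h0 i)%:P + h1 i *: 'X) (fun i => (k i)%:P).
eexists; split; first exact: s.
  by rewrite c /pC (mmap_rmorph (polyC : {rmorphism C -> {poly C}})); apply: eq_mmap.
move=> a w; rewrite -/(horner_eval w%:P _) -/(horner_eval a _).
rewrite (mmap_rmorph (horner_eval w%:P)) (mmap_rmorph (horner_eval a)).
apply: eq_mmap => [r|i] /=; rewrite /horner_eval !hornerE //=.
by congr (_ + _ + _); rewrite mulrC.
Qed.

Lemma cxD x y i : cx (x + y) i = cx x i + cx y i.
Proof. by rewrite /cx linearD rmorphD. Qed.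
Lemma cxZ (a : R) x i : cx (a *: x) i = a%:C%C * cx x i.
Proof. by rewrite /cx linearZ /= rmorphM. Qed.
Lemma cxN x i : cx (- x) i = - cx x i.
Proof. by rewrite /cx linearN rmorphN. Qed.
Lemma cx0 i : cx 0 i = 0.
Proof. by rewrite /cx linear0. Qed.

Lemma p_homog (c : R) x : p (c *: x) = c ^+ d * p x.
Proof.
rewrite !pE /meval -mmap_homog //; apply: eq_mmap => // i.
by rewrite linearZ.
Qed.

Definition line (x v : V) : {poly R} :=
  mmap polyC (fun i => (coord (vbasis {:V}) i x)%:P
                     + (coord (vbasis {:V}) i v)%:P * 'X) P.

Lemma lineE x v t : (line x v).[t] = p (x + t *: v).
Proof.
rewrite pE /line -/(horner_eval t _) (mmap_rmorph (horner_eval t)).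
apply: eq_mmap => [r|i] /=; rewrite /horner_eval ?hornerC // !hornerE /=.
by rewrite linearD linearZ /= mulrC.
Qed.

Lemma line_poly_line x v : line_poly p x v = line x v.
Proof.
apply: poly_ext => t; by rewrite (line_polyE (d := d)) ?lineE.
Qed.

Lemma line_size x v : (size (line x v) <= d.+1)%N /\ (line x v)`_d = p v.
Proof.
have [sL cL] := mmap_line_lead homP idfun (fun i => coord (vbasis {:V}) i x)
   (fun i => coord (vbasis {:V}) i v).
by split; [exact: sL | rewrite pE; exact: cL].
Qed.

Lemma line_complex x v w :
  (map_poly (real_complex R) (line x v)).[w] = pC (fun i => cx x i + w * cx v i).
Proof.
rewrite /line (mmap_rmorph (map_poly (real_complex R))).
rewrite -/(horner_eval w _) (mmap_rmorph (horner_eval w)).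
apply: eq_mmap => [r|i] /=; rewrite /horner_eval ?map_polyC ?hornerC //.
by rewrite rmorphD rmorphM /= !map_polyC map_polyX !hornerE mulrC.
Qed.

Lemma hyperbolic_neq0 e : hyperbolic d p e -> forall x (w : C),
  complex.Im w != 0 -> pC (fun i => cx x i + w * cx e i) != 0.
Proof.
case=> _ e0 rr x w w0; apply/negP => /eqP W.
have : complex.Im (- w) = 0.
  apply: (rr x); rewrite rootE line_poly_line line_complex -W; apply/eqP/eq_pC => i.
  by rewrite cxN mulrNN.
by case: (w) w0 => a b /= /negP b0 /eqP; rewrite oppr_eq0.
Qed.

Lemma complexRI (w : C) : w = (complex.Re w)%:C%C + 'i%C * (complex.Im w)%:C%C.
Proof. by case: w => a b; simpc. Qed.

(** By homogeneity, a root with nonzero imaginary part b can be moved to i by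
    a real translation and a division by b. *)
Lemma hyperbolicP e : 0 < p e ->
  (forall x, pC (fun i => cx x i + 'i%C * cx e i) != 0) -> hyperbolic d p e.
Proof.
move=> e0 H; split => //.
move=> x w; rewrite line_poly_line rootE line_complex => /eqP W.
apply/eqP/negPn/negP => b0.
have := H (- (complex.Im w)^-1 *: (x - complex.Re w *: e)).
have -> : pC (fun i => cx (- (complex.Im w)^-1 *: (x - complex.Re w *: e)) i +
       'i%C * cx e i) =
   pC (fun i => (- (complex.Im w)^-1)%:C%C * (cx x i + w * cx (- e) i)).
  apply: eq_pC => i; rewrite cxZ cxD !cxN cxZ.
  rewrite [in RHS](complexRI w) !rmorphN /= fmorphV.
  field; apply: contraNneq b0 => /complexI ->; exact: eqxx.
by rewrite pCZ W mulr0 eqxx.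
Qed.

Lemma eigenvalues e (he : hyperbolic d p e) x : exists rs : seq R,
  [/\ size rs = d,
      forall w : C, pC (fun i => cx x i + w * cx e i)
        = (p e)%:C%C * \prod_(r <- rs) (w + r%:C%C)
    & forall t : R, p (x + t *: e) = p e * \prod_(r <- rs) (t + r)].
Proof.
have e0 : 0 < p e by case: he.
suff [rs [srs E]] : exists rs : seq R, size rs = d /\ forall w : C,
    pC (fun i => cx x i + w * cx e i) = (p e)%:C%C * \prod_(r <- rs) (w + r%:C%C).
  exists rs; split=> // t.
  have := E t%:C%C.
  have -> : pC (fun i => cx x i + t%:C%C * cx e i) = (p (x + t *: e))%:C%C.
    by rewrite -pC_real; apply: eq_pC => i; rewrite cxD cxZ.
  move=> Et; apply: (@complexI R); rewrite [LHS]Et rmorphM rmorph_prod /=.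
  by congr (_ * _); apply: eq_bigr => r _; rewrite rmorphD.
set L := map_poly (real_complex R) (line x e).
have [sL cL] := line_size x e.
have {}sL : size L = d.+1.
  rewrite size_map_poly; apply/eqP; rewrite eqn_leq sL /= ltnNge.
  by apply/negP => /leq_sizeP/(_ d (leqnn d)) /eqP; rewrite cL gt_eqF.
have lL : lead_coef L = (p e)%:C%C by rewrite lead_coefE sL coef_map cL.
have [ws Lws] := closed_field_poly_normal L; rewrite lL in Lws.
have e0C : (p e)%:C%C != 0 :> C by rewrite fmorph_eq0 gt_eqF.
exists [seq - complex.Re w | w <- ws]; split.
  rewrite size_map; apply/eqP; rewrite -eqSS -sL Lws size_scale //.
  by rewrite size_prod_XsubC.
move=> w; rewrite -line_complex -/L Lws hornerZ horner_prod big_map.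
congr (_ * _); rewrite !big_seq; apply: eq_bigr => u uws.
rewrite !hornerE; congr (_ + _).
have : root L u by rewrite Lws rootZ // root_prod_XsubC.
rewrite rootE line_complex => u0.
have /eqP : complex.Im u == 0.
  by apply: contraTT u0 => /(hyperbolic_neq0 he); exact.
by case: u {uws u0} => a b /= ->; simpc; rewrite ?oppr0.
Qed.

End Complexification.

Section Interior.
Variables (R : realType) (V : vectType R) (d : nat) (p : V -> R) (e : V).
Hypothesis he : hyperbolic d p e.
Let hp : homog_polyfun d p. Proof. by case: he. Qed.
Let e0 : 0 < p e. Proof. by case: he. Qed.

Lemma eigenvaluesR x : exists rs : seq R, size rs = d /\ forall t : R,
  p (x + t *: e) = p e * \prod_(r <- rs) (t + r).
Proof. by have [rs [? _ ?]] := eigenvalues hp he x; exists rs. Qed.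

Lemma hypint_eig x rs : (forall t : R, p (x + t *: e) = p e * \prod_(r <- rs) (t + r)) ->
  hypint p e x <-> (forall r, r \in rs -> 0 < r).
Proof.
move=> E; split=> [H r rrs|H t t0].
  rewrite ltNge; apply/negP => r0.
  have := H (- r); rewrite oppr_ge0 => /(_ r0); rewrite E mulf_eq0 gt_eqF //=.
  by rewrite (big_rem r) //= addNr mul0r eqxx.
rewrite E mulf_neq0 ?gt_eqF // big_seq prodr_gt0 // => r /H r0.
by rewrite ltr_wpDl.
Qed.

Lemma hypcone_eig x rs : (forall t : R, p (x + t *: e) = p e * \prod_(r <- rs) (t + r)) ->
  hypcone p e x <-> (forall r, r \in rs -> 0 <= r).
Proof.
move=> E.
have E' t : p (t *: e - x) = (- 1) ^+ d * (p e * \prod_(r <- rs) (- t + r)).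
  by rewrite -E -(p_homog hp) scalerDr scalerA mulN1r opprK scaleN1r addrC.
split=> [H r rrs|H t].
  apply: H; rewrite E' (big_rem r) //= addNr mul0r !mulr0 //.
rewrite E' => /eqP; rewrite mulf_eq0 signr_eq0 mulf_eq0 gt_eqF //=.
rewrite prodf_seq_eq0 => /hasP[r /H r0 /=].
by rewrite addrC subr_eq0 => /eqP <-.
Qed.

Lemma hypint_gt0 x : hypint p e x -> 0 < p x.
Proof.
have [rs [_ E]] := eigenvaluesR x; move/(hypint_eig E) => H.
rewrite -[x]addr0 -(scale0r e) E mulr_gt0 // big_seq prodr_gt0 // => r /H r0.
by rewrite add0r.
Qed.

Lemma hypint_dir : hypint p e e.
Proof.
move=> t t0; rewrite -{1}[e]scale1r -scalerDl (p_homog hp) mulf_neq0 ?gt_eqF //.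
by rewrite exprn_gt0 // ltr_pwDl.
Qed.

Lemma hypintZ c x : 0 < c -> hypint p e x -> hypint p e (c *: x).
Proof.
move=> c0 H t t0.
have -> : c *: x + t *: e = c *: (x + (t / c) *: e).
  by rewrite scalerDr scalerA mulrCA divff ?mulr1 // gt_eqF.
rewrite (p_homog hp); apply: mulf_neq0; first by rewrite expf_neq0 ?gt_eqF.
by apply: H; rewrite divr_ge0 // ltW.
Qed.

Lemma hypintDe s x : 0 <= s -> hypint p e x -> hypint p e (x + s *: e).
Proof.
by move=> s0 H t t0; rewrite -addrA -scalerDl; apply: H; rewrite addr_ge0.
Qed.

Let seq_lb (rs : seq R) : (forall r, r \in rs -> 0 < r) ->
  exists2 s, 0 < s & forall r, r \in rs -> s < r.
Proof.
elim: rs => [|r rs IH] H; first by exists 1.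
have [|s s0 Hs] := IH; first by move=> u urs; apply: H; rewrite inE urs orbT.
have r0 : 0 < r by apply: H; rewrite mem_head.
exists (Num.min (r / 2) s); first by rewrite lt_min divr_gt0.
move=> u; rewrite inE gt_min => /orP[/eqP ->|/Hs ->]; last by rewrite orbT.
by apply/orP; left; lra.
Qed.

Let seq_ub (rs : seq R) : exists2 s, 0 < s & forall r, r \in rs -> 0 < r + s.
Proof.
elim: rs => [|r rs [s s0 Hs]]; first by exists 1.
exists (s + `|r|); first by rewrite ltr_pwDl.
move=> u; rewrite inE => /orP[/eqP ->|/Hs us].
  by have := ler_norm (- r); rewrite normrN; lra.
by rewrite addrA ltr_pwDl.
Qed.

(** The shift s is chosen below the least eigenvalue of x. *)
Lemma hypint_open x : hypint p e x -> exists2 s, 0 < s & hypint p e (x - s *: e).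
Proof.
have [rs [_ E]] := eigenvaluesR x; move/(hypint_eig E)/seq_lb => [s s0 Hs].
exists s => // t t0; rewrite -addrA -scaleNr -scalerDl E mulf_neq0 ?gt_eqF //.
by rewrite big_seq prodr_gt0 // => r /Hs sr; lra.
Qed.

Lemma hypint_unit x : exists2 s, 0 < s & hypint p e (x + s *: e).
Proof.
have [rs [_ E]] := eigenvaluesR x; have [s s0 Hs] := seq_ub rs.
exists s => // t t0; rewrite -addrA -scalerDl E mulf_neq0 ?gt_eqF //.
by rewrite big_seq prodr_gt0 // => r /Hs; lra.
Qed.

Lemma hypcone_int x :
  hypcone p e x <-> (forall s, 0 < s -> hypint p e (x + s *: e)).
Proof.
have [rs [_ E]] := eigenvaluesR x; rewrite (hypcone_eig E); split=> H.
  move=> s s0 t t0; rewrite -addrA -scalerDl E mulf_neq0 ?gt_eqF //.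
  by rewrite big_seq prodr_gt0 // => r /H; lra.
move=> r rrs; rewrite leNgt; apply/negP => r0.
have := H (- r); rewrite oppr_gt0 => /(_ r0 0 (lexx 0)).
rewrite scale0r addr0 E mulf_eq0 gt_eqF //=.
by rewrite (big_rem r) //= addNr mul0r eqxx.
Qed.

Lemma hypint_hypcone x : hypint p e x -> hypcone p e x.
Proof. by move=> H; apply/hypcone_int => s /ltW s0; apply: hypintDe. Qed.

End Interior.

Section Garding.
Variables (R : realType) (V : vectType R) (d : nat) (p : V -> R).
Local Notation C := R[i].

(** Deform x to 0 with c and e fixed. A real root t would contradict
    hyperbolicity along e, and for x = 0 the roots are - i / r, where r runs
    through the eigenvalues of c, which are positive. *)
Lemma half_plane_dir (hp : homog_polyfun d p) e (he : hyperbolic d p e)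
    c x (w : C) : hypint p e c -> 0 <= complex.Im w ->
  pC hp (fun i => cx x i + 'i%C * cx e i + w * cx c i) != 0.
Proof.
move=> ec w0; have [G [sG Gd GE]] := pC_line hp (fun i => 'i%C * cx e i) (cx x) (cx c).
have e0 : 0 < p e by case: he.
have c0 := hypint_gt0 he ec.
have l0 : pC hp (cx c) != 0 by rewrite pC_real fmorph_eq0 gt_eqF.
apply/negP => /eqP W; have := half_plane_homotopy l0 Gd sG.
move=> /(_ _ _ w) H; move: w0; rewrite leNgt => /negP; apply; apply: H.
- move=> a s _; rewrite GE.
  have -> : pC hp (fun i => 'i%C * cx e i + a%:C%C * cx x i + s%:C%C * cx c i) =
     pC hp (fun i => cx (a *: x + s *: c) i + 'i%C * cx e i).
    by apply: eq_pC => i; rewrite cxD !cxZ; ring.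
  by apply: (hyperbolic_neq0 hp he) => //=; rewrite oner_eq0.
- move=> u; rewrite GE => /eqP.
  have -> : pC hp (fun i => 'i%C * cx e i + 0 * cx x i + u * cx c i) =
     pC hp (fun i => 'i%C * cx e i + u * cx c i).
    by apply: eq_pC => i; ring.
  have iN0 : 'i%C != 0 :> C by rewrite neq0Ci.
  have [->|u0] := eqVneq u 0.
    have -> : pC hp (fun i => 'i%C * cx e i + 0 * cx c i) =
       pC hp (fun i => 'i%C * cx e i) by apply: eq_pC => i; ring.
    rewrite pCZ pC_real mulf_eq0 expf_eq0 (negbTE iN0) andbF /= fmorph_eq0.
    by rewrite gt_eqF.
  have -> : pC hp (fun i => 'i%C * cx e i + u * cx c i) =
     pC hp (fun i => u * (cx c i + ('i%C / u) * cx e i)).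
    by apply: eq_pC => i; field.
  have [rs [_ E ER]] := eigenvalues hp he c.
  rewrite pCZ E !mulf_eq0 expf_eq0 (negbTE u0) andbF /= fmorph_eq0 gt_eqF //=.
  rewrite prodf_seq_eq0 => /hasP[r rrs /= ur].
  have r0 : 0 < r by move/(hypint_eig he ER): ec => /(_ r rrs).
  have -> : u = (- r^-1)%:C%C * 'i%C.
    have r0C : r%:C%C != 0 :> C by rewrite fmorph_eq0 gt_eqF.
    have : 'i%C / u * u = - r%:C%C * u.
      by congr (_ * _); apply/eqP; rewrite -addr_eq0.
    rewrite divfK // => ->; rewrite rmorphN /= fmorphV; field.
    by [].
  by simpc => /=; rewrite oppr_lt0 invr_gt0.
- rewrite GE -W; apply: eq_pC => i; ring.
Qed.

End Garding.

(** * The theory of Garding *)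

Section GardingCone.
Variables (R : realType) (V : vectType R) (d : nat) (p : V -> R).
Local Notation C := R[i].
Implicit Types (e c x y : V).

Lemma hyperbolic_homog e : hyperbolic d p e -> homog_polyfun d p.
Proof. by case. Qed.

(** As c - s e is still interior for some s > 0, the imaginary vector i c splits
    into i s e and a remainder, to which half_plane_dir applies. *)
Lemma hyperbolic_int e c : hyperbolic d p e -> hypint p e c -> hyperbolic d p c.
Proof.
move=> he ec; have hp := hyperbolic_homog he.
apply: (@hyperbolicP _ _ _ _ hp) => [|x]; first exact: (hypint_gt0 he).
have [s s0 ecs] := hypint_open he ec.
have sC : s%:C%C != 0 :> C by rewrite fmorph_eq0 gt_eqF.
have -> : pC hp (fun i => cx x i + 'i%C * cx c i) =
    pC hp (fun i => s%:C%C * (cx (s^-1 *: x) i + 'i%C * cx e i +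
       ('i%C * (s^-1)%:C%C) * cx (c - s *: e) i)).
  apply: eq_pC => i; rewrite cxD cxN !cxZ !fmorphV /=; field.
  by [].
rewrite pCZ; apply: mulf_neq0; first by rewrite expf_neq0.
apply: (half_plane_dir hp he _ ecs).
by simpc => /=; rewrite invr_ge0 ltW.
Qed.

Lemma hypint_seg e b a : hyperbolic d p e -> hypint p e b -> 0 <= a <= 1 ->
  hypint p e ((1 - a) *: e + a *: b).
Proof.
move=> he eb /andP[a0 a1]; move: a0; rewrite le_eqVlt => /orP[/eqP <-|a0].
  by rewrite scale0r addr0 subr0 scale1r; apply: (hypint_dir he).
rewrite addrC; apply: hypintDe; first by lra.
by apply: (hypintZ he) => //; lra.
Qed.

(** Deform the direction e to b along a segment of interior directions: then
    p (i b' + w c) keeps its roots w in the lower half-plane, because p is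
    hyperbolic along each b'. At the end of the segment, w = i is not a root. *)
Lemma hypintD_neq0 e b c : hyperbolic d p e -> hypint p e b -> hypint p e c ->
  p (b + c) != 0.
Proof.
move=> he eb ec; have hp := hyperbolic_homog he.
have [G [sG Gd GE]] := pC_line hp (fun i => 'i%C * cx e i)
   (fun i => 'i%C * (cx b i - cx e i)) (cx c).
have l0 : pC hp (cx c) != 0.
  by rewrite pC_real fmorph_eq0 gt_eqF // (hypint_gt0 he).
apply/negP => /eqP W; have := half_plane_homotopy l0 Gd sG.
move=> /(_ _ _ 'i%C) /= H; suff: (1 : R) < 0 by rewrite ltr10.
apply: H.
- move=> a s a01; rewrite GE.
  have -> : pC hp (fun i => 'i%C * cx e i + a%:C%C * ('i%C * (cx b i - cx e i))
      + s%:C%C * cx c i) =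
     pC hp (fun i => cx (s *: c) i + 'i%C * cx ((1 - a) *: e + a *: b) i).
    by apply: eq_pC => i; rewrite !cxD !cxZ rmorphB rmorph1; ring.
  apply: hyperbolic_neq0; last by rewrite /= oner_eq0.
  by apply: (hyperbolic_int he); apply: hypint_seg.
- move=> u; rewrite GE => /eqP U; rewrite ltNge; apply/negP => u0.
  apply: (elimN eqP (half_plane_dir hp he (0 : V) ec u0)).
  by apply: etrans (eqP U); apply: eq_pC => i; rewrite cx0; ring.
- rewrite GE.
  transitivity (pC hp (fun i => 'i%C * cx (b + c) i)).
    by apply: eq_pC => i; rewrite cxD; ring.
  by rewrite pCZ pC_real W mulr0.
Qed.

Lemma hypintD e b c : hyperbolic d p e -> hypint p e b -> hypint p e c ->
  hypint p e (b + c).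
Proof.
move=> he eb ec t t0; rewrite -addrA; apply: (hypintD_neq0 he) => //.
by apply: hypintDe.
Qed.

Lemma hypint_sym e c : hyperbolic d p e -> hypint p e c -> hypint p c e.
Proof.
move=> he ec t; rewrite le_eqVlt => /orP[/eqP <-|t0].
  by rewrite scale0r addr0 gt_eqF //; case: he.
apply: (hypintD_neq0 he); first exact: (hypint_dir he).
exact: (hypintZ he).
Qed.

Lemma hypint_dirE e c : hyperbolic d p e -> hypint p e c ->
  hypint p c = hypint p e.
Proof.
suff sub e' c' : hyperbolic d p e' -> hypint p e' c' -> hypint p e' `<=` hypint p c'.
  move=> he ec; rewrite eqEsubset; split; last exact: sub.
  by apply: sub; [exact: (hyperbolic_int he ec) | exact: hypint_sym].
move=> he ec x ex t; rewrite le_eqVlt => /orP[/eqP <-|t0].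
  by rewrite scale0r addr0 gt_eqF // (hypint_gt0 he).
by apply: (hypintD_neq0 he) => //; apply: (hypintZ he).
Qed.

Section Cone.
Variable e : V.
Hypothesis he : hyperbolic d p e.

Lemma hypcone_intD x c : hypcone p e x -> hypint p e c -> hypint p e (x + c).
Proof.
move=> /(hypcone_int he) xe /(hypint_open he)[s s0 cs].
have -> : x + c = (x + s *: e) + (c - s *: e) by rewrite addrACA subrr addr0.
by apply: (hypintD he) => //; apply: xe.
Qed.

Lemma hypcone_dir : hypcone p e e.
Proof. exact: (hypint_hypcone he (hypint_dir he)). Qed.

Lemma hypconeD x y : hypcone p e x -> hypcone p e y -> hypcone p e (x + y).
Proof.
move=> ex /(hypcone_int he) ey; apply/(hypcone_int he) => s s0.
by rewrite -addrA; apply: hypcone_intD => //; apply: ey.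
Qed.

Lemma hypcone0 : hypcone p e 0.
Proof.
apply/(hypcone_int he) => s s0; rewrite add0r; apply: (hypintZ he) => //.
exact: (hypint_dir he).
Qed.

Lemma hypconeZ a x : 0 <= a -> hypcone p e x -> hypcone p e (a *: x).
Proof.
rewrite le_eqVlt => /orP[/eqP <- _|a0 /(hypcone_int he) ex].
  by rewrite scale0r; apply: hypcone0.
apply/(hypcone_int he) => s s0.
have -> : a *: x + s *: e = a *: (x + (s / a) *: e).
  by rewrite scalerDr scalerA mulrCA divff ?mulr1 // gt_eqF.
by apply: (hypintZ he) => //; apply: ex; rewrite divr_gt0.
Qed.

Lemma hypcone_convex : convex_cone (hypcone p e).
Proof. by move=> a b x y a0 b0 ex ey; apply: hypconeD; apply: hypconeZ. Qed.

(** An order unit argument: a small multiple of - v can be absorbed by s e. *)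
Lemma hypcone_closed x v : (forall s, 0 < s -> hypcone p e (x + s *: v)) ->
  hypcone p e x.
Proof.
move=> H; apply/(hypcone_int he) => s s0.
have [r r0 rv] := hypint_unit he (- v).
have -> : x + s *: e = (x + (s / r) *: v) + (s / r) *: (- v + r *: e).
  rewrite scalerDr scalerN scalerA divfK ?gt_eqF // addrA addrK //.
by apply: hypcone_intD; [apply: H|apply: (hypintZ he)]; rewrite ?divr_gt0.
Qed.

Lemma hypcone_interior x : hypint p e x <->
  exists2 s, 0 < s & hypcone p e (x - s *: e).
Proof.
split=> [/(hypint_open he)[s s0 xs]|[s s0 xs]].
  by exists s => //; apply: (hypint_hypcone he xs).
rewrite -(subrK (s *: e) x); apply: hypcone_intD => //.
by apply: (hypintZ he) => //; apply: (hypint_dir he).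
Qed.

End Cone.

Lemma hypcone_dirE e c : hyperbolic d p e -> hypint p e c ->
  hypcone p c = hypcone p e.
Proof.
suff sub e' c' : hyperbolic d p e' -> hypint p e' c' -> hypcone p e' `<=` hypcone p c'.
  move=> he ec; rewrite eqEsubset; split; last exact: sub.
  by apply: sub; [exact: (hyperbolic_int he ec) | exact: hypint_sym].
move=> he ec x ex; apply/(hypcone_int (hyperbolic_int he ec)) => s s0.
rewrite (hypint_dirE he ec); apply: (hypcone_intD he) => //.
exact: (hypintZ he).
Qed.

Lemma nneg_prod (rs : seq R) : (forall r, r \in rs -> 0 <= r) ->
  forall k, 0 <= (\prod_(r <- rs) ('X + r%:P))`_k.
Proof.
elim: rs => [|r rs IH] H k; first by rewrite big_nil coef1 ler0n.
have IH' : forall k, 0 <= (\prod_(r <- rs) ('X + r%:P))`_k.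
  by apply: IH => u urs; apply: H; rewrite inE urs orbT.
rewrite big_cons mulrDl coefD coefXM coefCM addr_ge0 //.
  by case: (k == 0)%N.
by rewrite mulr_ge0 // H // mem_head.
Qed.

Lemma horner_ge_coef (P : {poly R}) k t : (forall k, 0 <= P`_k) -> 0 <= t ->
  P`_k * t ^+ k <= P.[t].
Proof.
move=> H t0; rewrite (@horner_coef_wide _ (maxn (size P) k.+1)) ?leq_maxl //.
have kM : (k < maxn (size P) k.+1)%N by rewrite leq_maxr.
rewrite (bigD1 (Ordinal kM)) //= lerDl sumr_ge0 // => i _.
by rewrite mulr_ge0 ?exprn_ge0.
Qed.

(** The roots of t |-> p (x + t c) are nonpositive, since c may replace e as
    the direction that defines the cone. *)
Lemma hypcone_coef_ge0 e c x : hyperbolic d p e -> hypint p e c ->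
  hypcone p e x -> forall k, 0 <= (line_poly p x c)`_k.
Proof.
move=> he ec ex k; have hc := hyperbolic_int he ec.
have hp := hyperbolic_homog he.
have [rs [_ E]] := eigenvaluesR hc x.
have -> : line_poly p x c = p c *: \prod_(r <- rs) ('X + r%:P).
  apply: poly_ext => t; rewrite (line_polyE _ _ _ hp) E hornerZ horner_prod.
  by congr (_ * _); apply: eq_bigr => r _; rewrite !hornerE.
move: ex; rewrite -(hypcone_dirE he ec) => /(hypcone_eig hc E) rs0.
by rewrite coefZ mulr_ge0 ?nneg_prod // ltW //; case: hc.
Qed.

Lemma coef_ge0_hypcone e x : hyperbolic d p e ->
  (forall k, 0 <= (line_poly p x e)`_k) -> hypcone p e x.
Proof.
move=> he H; have hp := hyperbolic_homog he; have e0 : 0 < p e by case: he.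
apply/(hypcone_int he) => s s0 t t0; rewrite -addrA -scalerDl.
rewrite -(line_polyE _ _ _ hp) gt_eqF //.
apply: (@lt_le_trans _ _ ((line_poly p x e)`_d * (s + t) ^+ d)); last first.
  by apply: horner_ge_coef => //; lra.
rewrite (line_poly_line hp) (proj2 (line_size hp _ _)) mulr_gt0 // exprn_gt0 //; lra.
Qed.

Lemma hypcone_gt0_int e x : hyperbolic d p e ->
  hypcone p e x -> 0 < p x -> hypint p e x.
Proof.
move=> he ex x0 t t0; have hp := hyperbolic_homog he.
rewrite -(line_polyE _ _ _ hp) gt_eqF //.
apply: lt_le_trans x0 _.
have -> : p x = (line_poly p x e)`_0 * t ^+ 0.
  by rewrite expr0 mulr1 -horner_coef0 (line_polyE _ _ _ hp) scale0r addr0.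
apply: horner_ge_coef => // k; apply: (hypcone_coef_ge0 he) => //.
exact: (hypint_dir he).
Qed.

Lemma hypcone_mono e x v : hyperbolic d p e ->
  hypcone p e x -> hypcone p e v -> p x <= p (x + v).
Proof.
move=> he ex ev; have hp := hyperbolic_homog he.
have H s : 0 < s -> p x <= p (x + v + s *: e).
  move=> s0; have ec : hypint p e (v + s *: e) by move/(hypcone_int he): ev; exact.
  have := horner_ge_coef 0 (hypcone_coef_ge0 he ec ex) ler01.
  by rewrite expr0 mulr1 -horner_coef0 !(line_polyE _ _ _ hp) scale0r addr0 scale1r addrA.
have := @poly_ge0_closed _ (line_poly p (x + v) e - (p x)%:P) 0 1 ltr01.
rewrite !hornerE (line_polyE _ _ _ hp) scale0r addr0 subr_ge0; apply.
move=> t /andP[t0 _]; rewrite !hornerE (line_polyE _ _ _ hp) subr_ge0.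
exact: H.
Qed.

(** Order of vanishing at 0 is decreasing in the polynomial, because
    P`_k u^k <= P u <= Q u = O(u^m). *)
Lemma coef_vanish (P Q : {poly R}) m : (forall k, 0 <= P`_k) ->
  (forall u, 0 < u -> P.[u] <= Q.[u]) -> (forall k, (k < m)%N -> Q`_k = 0) ->
  forall k, (k < m)%N -> P`_k = 0.
Proof.
move=> P0 PQ Q0 k km; apply/eqP/negPn/negP => Pk0.
have Pk : 0 < P`_k by rewrite lt_def Pk0 P0.
have Qm : Q = drop_poly m Q * 'X^m.
  rewrite -[LHS](poly_take_drop m) (_ : take_poly m Q = 0) ?add0r //.
  by apply/polyP => i; rewrite coef_take_poly coef0; case: ifP => // /Q0.
have := @poly_ge0_closed _ (drop_poly m Q * 'X^(m - k) - (P`_k)%:P) 0 1 ltr01.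
rewrite !hornerE expr0n subn_eq0 leqNgt km mulr0 sub0r oppr_ge0 leNgt Pk => H.
suff: false by []; apply: H => t /andP[t0 _].
rewrite !hornerE subr_ge0 -(ler_pM2r (exprn_gt0 k t0)).
apply: le_trans (horner_ge_coef k P0 (ltW t0)) _; apply: le_trans (PQ _ t0) _.
by rewrite {1}Qm !hornerE -mulrA -exprD subnK // ltnW.
Qed.

(** Eigenvalues increase along the cone, so the multiplicity of the eigenvalue
    0 decreases; the comparison of p (x + u y) with p (x' + u y') as u tends to
    0 shows it without ordering the eigenvalues. *)
Lemma mult_mono e x x' y y' m : hyperbolic d p e ->
  hypcone p e x -> hypcone p e (x' - x) ->
  hypint p e y -> hypcone p e (y' - y) ->
  (forall k, (k < m)%N -> (line_poly p x' y')`_k = 0) ->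
  forall k, (k < m)%N -> (line_poly p x y)`_k = 0.
Proof.
move=> he ex exx ey eyy H; have hp := hyperbolic_homog he.
apply: coef_vanish H; first exact: (hypcone_coef_ge0 he).
move=> u u0; rewrite !(line_polyE _ _ _ hp).
have -> : x' + u *: y' = (x + u *: y) + ((x' - x) + u *: (y' - y)).
  by rewrite addrACA -scalerDr !subrKC.
have uZ z : hypcone p e z -> hypcone p e (u *: z) by apply: (hypconeZ he); exact: ltW.
apply: (hypcone_mono he) => //; apply: (hypconeD he) => //; apply: uZ => //.
exact: (hypint_hypcone he ey).
Qed.

End GardingCone.

(** * Directional derivatives and linear pullbacks *)

Section RealRootedDerivative.
Variable R : realType.
Local Notation C := R[i].

(** The Gauss-Lucas argument: each summand 1 / (u - w) of the logarithmic
    derivative has an imaginary part of sign opposite to that of u. *)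
Lemma log_deriv_prod (ws : seq C) (u : C) :
  (forall w, w \in ws -> complex.Im w = 0) -> complex.Im u != 0 ->
  let D := \prod_(w <- ws) ('X - w%:P) in
  [/\ D.[u] != 0, complex.Im u * complex.Im (D^`().[u] / D.[u]) <= 0
    & ws != [::] -> complex.Im u * complex.Im (D^`().[u] / D.[u]) < 0].
Proof.
move=> H u0; elim: ws H => [|w ws IH] H /=.
  rewrite big_nil -[1]/(1%:P) derivC horner0 mul0r /= mulr0 hornerC.
  by split; rewrite ?oner_eq0.
have [|D0 Dle _] := IH; first by move=> v vws; apply: H; rewrite inE vws orbT.
have w0 : complex.Im w = 0 by apply: H; rewrite mem_head.
rewrite !big_cons; set D1 := \prod_(j <- ws) _ in D0 Dle *.
have v0 : u - w != 0.
  apply: contraNneq u0 => /eqP; rewrite subr_eq0 => /eqP ->.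
  by rewrite w0.
have lt0 : complex.Im u * complex.Im (u - w)^-1 < 0.
  case: (u) (w) u0 w0 => [a b] [c e] /= b0 ->; rewrite subr0.
  have n0 : 0 < (a - c) ^+ 2 + b ^+ 2 by rewrite ltr_wpDl ?sqr_ge0 // exprn_even_gt0.
  by rewrite mulrN oppr_lt0 mulrA divr_gt0 // -expr2 exprn_even_gt0.
have -> : (('X - w%:P) * D1)^`().[u] / (('X - w%:P) * D1).[u] =
    (u - w)^-1 + D1^`().[u] / D1.[u].
  rewrite derivM !hornerE derivXsubC hornerC; field.
  by rewrite D0.
have im : complex.Im u * complex.Im ((u - w)^-1 + D1^`().[u] / D1.[u]) < 0.
  have -> : complex.Im ((u - w)^-1 + D1^`().[u] / D1.[u]) =
      complex.Im (u - w)^-1 + complex.Im (D1^`().[u] / D1.[u]).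
    by case: (u - w)^-1 => ? ?; case: (D1^`().[u] / D1.[u]).
  by rewrite mulrDr; lra.
by split; [rewrite !hornerE mulf_neq0 | exact: ltW | ].
Qed.

Lemma real_rooted_deriv (P : {poly R}) :
  (1 < size P)%N -> real_rooted P -> real_rooted P^`().
Proof.
move=> sP rP u; rewrite -deriv_map; set Q := map_poly _ P => Q'u.
have sQ : (1 < size Q)%N by rewrite size_map_poly.
have Q0 : lead_coef Q != 0 by rewrite lead_coef_eq0 -size_poly_gt0 ltnW.
have [ws Qws] := closed_field_poly_normal Q.
apply/eqP/negPn/negP => u0.
have [|D0 _ /(_ _)] := @log_deriv_prod ws u _ u0.
  move=> w wws; apply: rP; rewrite -/Q Qws rootZ //.
  by rewrite root_prod_XsubC.
have -> : ws != [::].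
  by apply/eqP => ws0; move: sQ; rewrite Qws ws0 big_nil size_scale // size_poly1.
move: Q'u; rewrite rootE Qws derivZ hornerZ mulf_eq0 (negbTE Q0) /= => /eqP ->.
by rewrite mul0r mulr0 ltxx => /(_ isT).
Qed.

Lemma real_rooted_derivn (P : {poly R}) k :
  (k < size P)%N -> real_rooted P -> real_rooted P^`(k).
Proof.
move=> kP rP; elim: k kP => [|k IH] kP; first by rewrite derivn0.
rewrite derivnS; apply: real_rooted_deriv; last exact/IH/ltnW.
rewrite ltnNge; apply/negP => /leq_sizeP/(_ ((size P).-1 - k)%N).
rewrite coef_derivn subnKC; last by lia.
have -> : (1 <= (size P).-1 - k)%N by lia.
move=> /(_ isT) /eqP; rewrite -mulr_natr mulf_eq0 pnatr_eq0 -lead_coefE.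
rewrite lead_coef_eq0 -size_poly_eq0 => /orP[/eqP sP0|]; first by rewrite sP0 in kP.
by rewrite eqn0Ngt ffact_gt0 -ltnS prednK ?(ltnW kP) ?(leq_trans _ kP).
Qed.

Lemma real_rooted_opp (P : {poly R}) :
  real_rooted P -> real_rooted (P \Po (- 'X)).
Proof.
move=> rP w; rewrite map_comp_poly rmorphN /= map_polyX rootE horner_comp.
rewrite !hornerE => rw; have := rP (- w); rewrite rootE => /(_ rw).
by case: (w) => a b /= /eqP; rewrite oppr_eq0 => /eqP.
Qed.

End RealRootedDerivative.

Section HomogeneousFunctions.
Variables (R : realType) (V : vectType R).
Local Notation N := (\dim {:V}).

(** Homogeneity as a function suffices: the component of degree d of P takes
    the same values as P. *)
Lemma homog_polyfunP d (f : V -> R) :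
  (exists P : mpoly N R, forall x, f x = meval (fun i => coord (vbasis {:V}) i x) P) ->
  (forall c x, f (c *: x) = c ^+ d * f x) -> homog_polyfun d f.
Proof.
move=> [P fE] fZ; exists (pihomog mdeg d P); split; first exact: pihomogP.
move=> x; set v := fun i => _.
pose Q : {poly R} := \sum_(m <- msupp P)
  (mcoeff m P * \prod_i v i ^+ m i) *: 'X^(mdeg m).
suff /(congr1 (fun q : {poly R} => q`_d)) : Q = f x *: 'X^d.
  rewrite coefZ coefXn eqxx mulr1 => <-.
  rewrite coef_sum pihomogE (raddf_sum (meval v)) [RHS]big_mkcond /=.
  apply: eq_bigr => m _; rewrite coefZ coefXn eq_sym; case: eqP => _.
    by rewrite mulr1 mevalZ mevalX.
  by rewrite mulr0.
apply: poly_ext => c; rewrite hornerZ hornerXn mulrC -fZ fE mevalE horner_sum.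
apply: eq_bigr => m _; rewrite hornerZ hornerXn -mulrA; congr (_ * _).
rewrite mdegE -prodrXr -big_split /=; apply: eq_bigr => i _.
by rewrite linearZ /= exprMn mulrC.
Qed.

End HomogeneousFunctions.

Section LinearPullback.
Variables (R : realType) (V W : vectType R).

Lemma homog_polyfun_comp d (f : V -> R) (g : {linear W -> V}) :
  homog_polyfun d f -> homog_polyfun d (f \o g).
Proof.
move=> hf; have fZ := p_homog hf; case: hf => P [_ fE].
have gE y i : coord (vbasis {:V}) i (g y) = \sum_j
    coord (vbasis {:W}) j y * coord (vbasis {:V}) i (g (vbasis {:W})`_j).
  rewrite {1}(coord_vbasis (memvf y)) linear_sum linear_sum.
  by apply: eq_bigr => j _; rewrite linearZ linearZ.
apply: homog_polyfunP => [|c x]; last by rewrite /= linearZ fZ.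
exists (mmap (@mpolyC _ R) (fun i => \sum_(j < \dim {:W})
  (coord (vbasis {:V}) i (g (vbasis {:W})`_j)) *: mpolyX R (mnm1 j)) P) => y.
rewrite (mmap_rmorph (meval _)) /= fE; apply: eq_mmap => [c|i] /=.
  by rewrite mevalC.
rewrite gE (raddf_sum (meval _)); apply: eq_bigr => j _.
by rewrite /= mevalZ mevalXU mulrC.
Qed.

Lemma hyperbolic_comp d (f : V -> R) (g : {linear W -> V}) (e : W) :
  hyperbolic d f (g e) -> hyperbolic d (f \o g) e.
Proof.
case=> hf e0 rr; have hfg := homog_polyfun_comp g hf; split=> // x.
have -> : line_poly (f \o g) x (- e) = line_poly f (g x) (- g e); last exact: rr.
apply: poly_ext => t; rewrite (line_polyE _ _ _ hf) (line_polyE _ _ _ hfg) /=.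
by rewrite linearD linearZ linearN.
Qed.

End LinearPullback.

Section DirectionalDerivatives.
Variables (R : realType) (V : vectType R) (d : nat) (p : V -> R).
Hypothesis hp : homog_polyfun d p.
Implicit Types (e x : V).

Lemma derive1n_horner (P : {poly R}) k : derive1n k (horner P) = horner P^`(k).
Proof. by elim: k => [//|k IH]; rewrite derive1nS IH -derivE. Qed.

Lemma dirderiv_horner e k x :
  dirderiv e k p x = ((line_poly p x e)^`(k)).[0].
Proof.
rewrite /dirderiv -derive1n_horner; congr (derive1n k _ 0).
by apply/funext => t; rewrite (line_polyE _ _ _ hp).
Qed.

Lemma dirderivE e k x : dirderiv e k p x = (line_poly p x e)`_k *+ k`!.
Proof. by rewrite dirderiv_horner horner_coef0 coef_derivn addn0 ffactnn. Qed.

Lemma dirderiv_line e k x t :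
  dirderiv e k p (x + t *: e) = ((line_poly p x e)^`(k)).[t].
Proof.
rewrite dirderivE nderivn_def hornerMn; congr (_ *+ _).
set Q := line_poly p x e.
have -> : line_poly p (x + t *: e) e = \poly_(i < size Q) (Q^`N(i)).[t].
  apply: poly_ext => h; rewrite (line_polyE _ _ _ hp) -addrA -scalerDl.
  rewrite -(line_polyE _ _ _ hp) nderiv_taylor; last exact: mulrC.
  by rewrite horner_poly.
rewrite coef_poly; case: ltnP => // /leq_sizeP sQ.
rewrite (_ : Q^`N(k) = 0) ?horner0 //; apply/polyP => i.
by rewrite coef_nderivn sQ ?mul0rn ?coef0 // leq_addr.
Qed.

Lemma line_coef_lead x v : (line_poly p x v)`_d = p v.
Proof. by rewrite (line_poly_line hp) (proj2 (line_size hp _ _)). Qed.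

Lemma line_coef_dirZ x v (c : R) k :
  (line_poly p x (c *: v))`_k = c ^+ k * (line_poly p x v)`_k.
Proof.
set P := line_poly p x v.
have -> : line_poly p x (c *: v) = \poly_(i < size P) (c ^+ i * P`_i).
  apply: poly_ext => t; rewrite (line_polyE _ _ _ hp) scalerA -(line_polyE _ _ _ hp).
  rewrite horner_poly horner_coef; apply: eq_bigr => i _.
  by rewrite exprMn; ring.
by rewrite coef_poly; case: ltnP => // /leq_sizeP ->; rewrite ?mulr0.
Qed.

Lemma line_coefZ c e x k :
  (line_poly p (c *: x) e)`_k * c ^+ k = c ^+ d * (line_poly p x e)`_k.
Proof.
set P := line_poly p (c *: x) e.
have : \poly_(i < size P) (P`_i * c ^+ i) = c ^+ d *: line_poly p x e.
  apply: poly_ext => t; rewrite hornerZ (line_polyE _ _ _ hp) -(p_homog hp).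
  rewrite scalerDr scalerA -(line_polyE _ _ _ hp) horner_poly horner_coef.
  by apply: eq_bigr => i _; rewrite exprMn mulrA.
move/(congr1 (fun q : {poly R} => q`_k)); rewrite coefZ => <-.
by rewrite coef_poly; case: ltnP => // /leq_sizeP ->; rewrite ?mul0r.
Qed.

Lemma homog_polyfun_dirderiv e k : (k <= d)%N ->
  homog_polyfun (d - k) (dirderiv e k p).
Proof.
move=> kd; apply: homog_polyfunP.
  case: (hp) => P [_ pE].
  pose S := mmap (polyC \o @mpolyC (\dim {:V}) R) (fun i => (mpolyX R (mnm1 i))%:P +
    ((mpolyC _ (coord (vbasis {:V}) i e)))%:P * 'X) P.
  exists (S`_k *+ k`!) => x; rewrite dirderivE mevalMn; congr (_ *+ _).
  set v := fun i => _.
  suff -> : line_poly p x e = map_poly (meval v) S by rewrite coef_map.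
  apply: poly_ext => t; rewrite (line_polyE _ _ _ hp) pE.
  rewrite /S (mmap_rmorph (map_poly (meval v))) -/(horner_eval t _).
  rewrite (mmap_rmorph (horner_eval t)); apply: eq_mmap => [c|i] /=.
    by rewrite map_polyC /horner_eval hornerC /= mevalC.
  rewrite rmorphD rmorphM /= !map_polyC map_polyX /horner_eval !hornerE /=.
  by rewrite mevalXU mevalC linearD linearZ /= mulrC.
move=> c x; rewrite !dirderivE mulrnAr; congr (_ *+ _).
have [->|c0] := eqVneq c 0; last first.
  apply: (mulIf (expf_neq0 k c0)); rewrite line_coefZ mulrAC -exprD subnK //.
rewrite scale0r; have -> : line_poly p 0 e = p e *: 'X^d.
  apply: poly_ext => t; rewrite (line_polyE _ _ _ hp) add0r (p_homog hp).
  by rewrite !hornerE mulrC.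
rewrite coefZ coefXn expr0n subn_eq0; case: ltngtP kd => // [kd _|-> _].
  by rewrite mulr0 mul0r.
by rewrite mulr1 mul1r (line_poly_line hp) (proj2 (line_size hp _ _)).
Qed.

Lemma line_dirderiv e k x : (k <= d)%N ->
  line_poly (dirderiv e k p) x e = (line_poly p x e)^`(k).
Proof.
move=> kd; apply: poly_ext => t.
by rewrite (line_polyE _ _ _ (homog_polyfun_dirderiv e kd)) dirderiv_line.
Qed.

(** Derivatives of real-rooted polynomials are real-rooted. *)
Lemma hyperbolic_dirderiv e k : hyperbolic d p e -> (k <= d)%N ->
  hyperbolic (d - k) (dirderiv e k p) e.
Proof.
move=> he kd; have hk := homog_polyfun_dirderiv e kd.
have e0 : 0 < p e by case: he.
split=> // [|x].
  rewrite -(proj2 (line_size hk 0 e)) -(line_poly_line hk) line_dirderiv //.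
  rewrite coef_derivn subnKC // (line_poly_line hp) (proj2 (line_size hp _ _)).
  by rewrite pmulrn_lgt0 // ffact_gt0.
have lineN (q : V -> R) n y v : homog_polyfun n q ->
    line_poly q y (- v) = line_poly q y v \Po (- 'X).
  move=> hq; apply: poly_ext => t; rewrite horner_comp !hornerE.
  by rewrite !(line_polyE _ _ _ hq) scalerN scaleNr.
rewrite (lineN _ _ _ _ hk); apply: real_rooted_opp; rewrite line_dirderiv //.
apply: real_rooted_derivn.
  rewrite ltnNge; apply/negP => sk.
  have : (line_poly p x e)`_d = 0 by rewrite nth_default // (leq_trans sk).
  by rewrite (line_poly_line hp) (proj2 (line_size hp _ _)) => /eqP; rewrite gt_eqF.
have -> : line_poly p x e = (line_poly p x (- e)) \Po (- 'X).
  by rewrite -(lineN _ _ _ _ hp) opprK.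
by apply: real_rooted_opp; case: he.
Qed.

End DirectionalDerivatives.

(** * Faces and extremal vectors of closed pointed cones *)

(** The nonzero vectors that span extreme rays, described without mentioning
    faces. *)
Definition extremal (R : realType) (V : lmodType R) (K : set V) (x : V) : Prop :=
  [/\ x != 0, K x & forall y, K y -> K (x - y) -> exists a : R, y = a *: x].

(** A set stable under linear combinations is a subspace, here of finite
    dimension; take a subspace of largest dimension inside it. *)
Lemma vspan_sub (R : realType) (V : vectType R) (C D : set V) :
  D 0 -> (forall (a : R) x y, D x -> D y -> D (a *: x + y)) -> C `<=` D ->
  forall x, x \in vspan C -> D x.
Proof.
move=> D0 Dlin CD.
have [U UD] : exists U : {vspace V}, forall x, (x \in U) <-> D x.
  have max n (U : {vspace V}) : (\dim {:V} - \dim U <= n)%N ->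
      (forall x, x \in U -> D x) -> exists U : {vspace V}, forall x, (x \in U) <-> D x.
    elim: n U => [|n IH] U dU UD.
      exists U => x; split; first exact: UD.
      have -> : U = fullv; last by rewrite memvf.
      by apply/eqP; rewrite eqEdim subvf -subn_eq0 -leqn0.
    have [DU|] := pselect (forall x, D x -> x \in U).
      by exists U => x; split; [exact: UD | exact: DU].
    move=> /existsNP[x /not_implyP[Dx /negP xU]].
    apply: (IH (U + <[x]>)%VS).
      have : (\dim U < \dim (U + <[x]>)%VS)%N.
        rewrite ltn_neqAle dimvS ?addvSl // andbT; apply: contra xU => /eqP dUx.
        have /eqP -> : U == (U + <[x]>)%VS by rewrite eqEdim addvSl dUx /=.
        by rewrite (subvP (addvSr _ _)) // memv_line.
      have := dimvS (subvf (U + <[x]>)%VS); lia.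
    by move=> y /memv_addP[u uU [_ /vlineP[a ->] ->]]; rewrite addrC; apply/Dlin/UD.
  by apply: (max _ 0%VS (leqnn _)) => x; rewrite memv0 => /eqP ->.
move=> x; have [_ /(_ U)] := vspanP C.
by move=> H /(subvP (H _)) xU; apply/UD/xU => y /CD /UD.
Qed.

Section ClosedPointedCone.
Variables (R : realType) (V : vectType R) (K : set V).
Hypothesis Kconv : convex_cone K.
Hypothesis Kpt : pointed_cone K.
Hypothesis Kcl : forall x v, (forall s : R, 0 < s -> K (x + s *: v)) -> K x.

Lemma coneD x y : K x -> K y -> K (x + y).
Proof. by move=> Kx Ky; rewrite -[x]scale1r -[y]scale1r; apply: Kconv. Qed.

Lemma coneZ (a : R) x : 0 <= a -> K x -> K (a *: x).
Proof. by move=> a0 Kx; rewrite -[a *: x]addr0 -(scale0r x); apply: Kconv. Qed.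

Lemma cone0 x : K x -> K 0.
Proof. by move=> Kx; rewrite -(scale0r x); apply: coneZ. Qed.

Lemma cone_opp x : K x -> K (- x) -> x = 0.
Proof.
move=> Kx KNx; have : (K `&` [set x | K (- x)]) x by split.
by rewrite Kpt.
Qed.

(** The right-hand side describes a face that contains z, and any face that
    contains z = (z - s x) + s x must contain x. *)
Lemma min_faceP z x : K z ->
  min_face K z x <-> K x /\ exists2 s : R, 0 < s & K (z - s *: x).
Proof.
move=> Kz; split; last first.
  move=> [Kx [s s0 Kzx]] F [[_ Fconv _ Fext] Fz].
  have Fz' : F ((z - s *: x) + s *: x) by rewrite subrK.
  have [_ Fsx] := Fext _ _ Kzx (coneZ (ltW s0) Kx) Fz'.
  have := Fconv s^-1 0 _ _ _ (lexx 0) Fsx Fsx; rewrite scale0r addr0 scalerA.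
  by rewrite mulVf ?gt_eqF // scale1r; apply; rewrite invr_ge0 ltW.
apply: (_ : min_face K z `<=`
   [set x | K x /\ exists2 s : R, 0 < s & K (z - s *: x)]).
apply: bigcap_inf; split; last first.
  by split=> //; exists 1 => //; rewrite scale1r subrr; apply: cone0 Kz.
split.
- by exists z; split=> //; exists 1 => //; rewrite scale1r subrr; apply: cone0 Kz.
- move=> a b u v a0 b0 [Ku [s s0 Ks]] [Kv [t t0 Kt]].
  split; first exact: Kconv.
  have as0 : 0 <= a / s by rewrite divr_ge0 // ltW.
  have bt0 : 0 <= b / t by rewrite divr_ge0 // ltW.
  pose r := (a / s + b / t + 1)^-1.
  have r0 : 0 < r by rewrite invr_gt0; lra.
  have e1 : r * (a / s) + r * (b / t) + r = 1.
    by rewrite -mulrDr -[X in _ + X]mulr1 -mulrDr mulVf // gt_eqF // -invr_gt0.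
  exists r => //.
  have -> : z - r *: (a *: u + b *: v) = r *: z +
      (r * (a / s)) *: (z - s *: u) + (r * (b / t)) *: (z - t *: v).
    rewrite !scalerBr !scalerA -!mulrA !mulVf ?gt_eqF // !mulr1.
    rewrite [r *: z + _]addrA addrACA -!scalerDl.
    rewrite -[r + _ + _]addrA [r + _]addrC e1 scale1r -opprD.
    by rewrite scalerDr !scalerA.
  have rr : 0 <= r by exact: ltW.
  apply: coneD; [apply: coneD|].
  - exact: coneZ.
  - by apply: coneZ; [exact: mulr_ge0|].
  - by apply: coneZ; [exact: mulr_ge0|].
- by move=> u [].
- move=> u v Ku Kv [_ [s s0 Ks]]; split; split=> //; exists s => //.
    have -> : z - s *: u = (z - s *: (u + v)) + s *: v.
      by rewrite scalerDr opprD addrA subrK.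
    by apply: coneD => //; apply: coneZ => //; exact: ltW.
  have -> : z - s *: v = (z - s *: (u + v)) + s *: u.
    by rewrite scalerDr [s *: u + _]addrC opprD addrA subrK.
  by apply: coneD => //; apply: coneZ => //; exact: ltW.
Qed.

Lemma min_face_id z : min_face K z z.
Proof. by move=> F []. Qed.

Lemma min_face_sub z : K z -> min_face K z `<=` K.
Proof. by move=> Kz x /(min_faceP _ Kz) []. Qed.

Lemma min_faceW z x : K z -> K x -> K (z - x) -> min_face K z x.
Proof.
by move=> Kz Kx Kzx; apply/(min_faceP _ Kz); split=> //; exists 1; rewrite ?scale1r.
Qed.

Lemma min_face_is_face z : K z -> is_face K (min_face K z).
Proof.
move=> Kz; split.
- by exists z; exact: min_face_id.
- move=> a b x y a0 b0 Fx Fy F FF.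
  by have [[_ Fconv _ _] _] := FF; apply: Fconv => //; [apply: Fx|apply: Fy].
- exact: min_face_sub.
- move=> x y Kx Ky Fxy; split=> F FF; have [[_ _ _ Fext] _] := FF.
    by have [] := Fext x y Kx Ky (Fxy F FF).
  by have [] := Fext x y Kx Ky (Fxy F FF).
Qed.

Lemma min_face_mono z x : K z -> min_face K z x -> min_face K x `<=` min_face K z.
Proof.
by move=> Kz Fx y; apply; split=> //; exact: min_face_is_face.
Qed.

Lemma min_face_span z x : K z -> x \in vspan (min_face K z) ->
  exists a b, [/\ min_face K z a, min_face K z b & x = a - b].
Proof.
move=> Kz; have [_ Fc _ _] := min_face_is_face Kz; have Fz := min_face_id (z := z).
pose D := [set x | exists a b, [/\ min_face K z a, min_face K z b & x = a - b]].
apply: (@vspan_sub _ _ _ D).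
- by exists z, z; rewrite subrr.
- move=> c _ _ [a [b [Fa Fb ->]]] [a' [b' [Fa' Fb' ->]]].
  have [c0|c0] := leP 0 c.
    exists (c *: a + 1 *: a'), (c *: b + 1 *: b'); split; [exact: Fc|exact: Fc|].
    by rewrite !scale1r scalerBr opprD addrACA.
  have Nc0 : 0 <= - c by rewrite oppr_ge0 ltW.
  exists (- c *: b + 1 *: a'), (- c *: a + 1 *: b'); split; [exact: Fc|exact: Fc|].
  rewrite !scale1r scalerBr !scaleNr opprD opprK [RHS]addrACA; congr (_ + _).
  by rewrite addrC.
- move=> a Fa; exists (1 *: a + 1 *: z), z; split=> //; first exact: Fc.
  by rewrite !scale1r addrK.
Qed.

Lemma min_face_cap z x : K z -> x \in vspan (min_face K z) -> K x ->
  min_face K z x.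
Proof.
move=> Kz /(min_face_span Kz)[a [b [Fa Fb xE]]] Kx.
have [_ _ _ Fext] := min_face_is_face Kz.
have [|//] := Fext x b Kx (min_face_sub Kz Fb).
by rewrite xE subrK.
Qed.

Lemma mem_vspan (C : set V) x : C x -> x \in vspan C.
Proof. by have [H _] := vspanP C; exact: H. Qed.

(** Were the ray never to leave K, closedness would put - v in K. *)
Lemma cone_exit u v : K u -> K v -> v != 0 ->
  exists s : R, [/\ 0 <= s, K (u - s *: v),
    (forall t, 0 <= t -> K (u - t *: v) -> t <= s)
    & forall t, 0 < t -> ~ K ((u - s *: v) - t *: v)].
Proof.
move=> Ku Kv v0.
pose S := [set s : R | 0 <= s /\ K (u - s *: v)].
have S0 : S 0 by split=> //; rewrite scale0r subr0.
have Sdown s t : S s -> 0 <= t -> t <= s -> S t.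
  move=> [s0 Ks] t0 ts; split=> //.
  have -> : u - t *: v = (u - s *: v) + (s - t) *: v.
    by rewrite scalerBl addrA subrK.
  by apply: coneD => //; apply: coneZ => //; rewrite subr_ge0.
have Sub : has_ubound S.
  apply: contrapT => nb; apply/negP: v0; rewrite negbK; apply/eqP.
  apply: cone_opp => //; apply: (Kcl (v := u)) => r r0.
  have [s [Ss rs]] : exists s, S s /\ r^-1 < s.
    apply: contrapT => /forallNP H; apply: nb; exists r^-1 => s Ss.
    by rewrite leNgt; apply/negP => ?; apply: (H s).
  have [_ Kr] : S r^-1 by apply: Sdown Ss _ (ltW rs); rewrite invr_ge0 ltW.
  have -> : - v + r *: u = r *: (u - r^-1 *: v).
    by rewrite scalerBr scalerA divff ?gt_eqF // scale1r addrC.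
  by apply: coneZ => //; exact: ltW.
have hS : has_sup S by split=> //; exists 0.
have s0 : 0 <= sup S by apply: ub_le_sup.
have Ks : K (u - sup S *: v).
  apply: (Kcl (v := v)) => r r0; have [t [t0 Kt] st] := sup_adherent r0 hS.
  have -> : u - sup S *: v + r *: v = (u - t *: v) + (t - (sup S - r)) *: v.
    by rewrite !scalerBl opprB !addrA subrK addrAC.
  by apply: coneD => //; apply: coneZ => //; rewrite subr_ge0 ltW.
have smax t : 0 <= t -> K (u - t *: v) -> t <= sup S.
  by move=> t0 Kt; apply: ub_le_sup.
exists (sup S); split=> // t t0.
rewrite -addrA -opprD -scalerDl => /smax; rewrite gerDl.
by move=> H; have := H (addr_ge0 s0 (ltW t0)); rewrite leNgt t0.
Qed.

(** Otherwise x would lie in the span of the face of w, hence in that face, and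
    one could step from w against x inside K. *)
Lemma min_face_dim_lt u w x : K u -> min_face K u w -> min_face K u x ->
  (forall t : R, 0 < t -> ~ K (w - t *: x)) ->
  (\dim (vspan (min_face K w)) < \dim (vspan (min_face K u)))%N.
Proof.
move=> Ku Fw Fx H; have Kw := min_face_sub Ku Fw.
have sub : (vspan (min_face K w) <= vspan (min_face K u))%VS.
  have [_] := vspanP (min_face K w); apply=> y Fy /=.
  by apply: mem_vspan; exact: (min_face_mono Ku Fw).
rewrite ltn_neqAle dimvS // andbT; apply/eqP => dE.
have /eqP E : vspan (min_face K w) == vspan (min_face K u).
  by rewrite eqEdim sub dE /=.
have := mem_vspan Fx; rewrite -E => /(min_face_cap Kw)/(_ (min_face_sub Ku Fx)).
by move=> /(min_faceP _ Kw)[_ [t /H]].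
Qed.

Lemma extremalZ (a : R) x : 0 < a -> extremal K x -> extremal K (a *: x).
Proof.
move=> a0 [x0 Kx H]; split; first by rewrite scaler_eq0 negb_or gt_eqF.
  by apply: coneZ => //; exact: ltW.
move=> y Ky Kay; have [||b yE] := H (a^-1 *: y).
- by apply: coneZ => //; rewrite invr_ge0 ltW.
- have -> : x - a^-1 *: y = a^-1 *: (a *: x - y).
    by rewrite scalerBr scalerA mulVf ?gt_eqF // scale1r.
  by apply: coneZ => //; rewrite invr_ge0 ltW.
exists b; rewrite scalerA mulrC -scalerA -yE scalerA divff ?gt_eqF //.
by rewrite scale1r.
Qed.

Definition extremal_sum (u : V) : Prop :=
  exists2 xs : seq V, (forall x, x \in xs -> extremal K x) & u = \sum_(x <- xs) x.

Lemma extremal_sumD u v : extremal_sum u -> extremal_sum v -> extremal_sum (u + v).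
Proof.
move=> [xs xsE ->] [ys ysE ->]; exists (xs ++ ys); last by rewrite big_cat.
by move=> x; rewrite mem_cat => /orP[/xsE|/ysE].
Qed.

Lemma extremal_sumZ (a : R) u : 0 <= a -> extremal_sum u -> extremal_sum (a *: u).
Proof.
rewrite le_eqVlt => /orP[/eqP <- _|a0 [xs xsE ->]].
  by exists [::]; rewrite ?big_nil ?scale0r.
exists [seq a *: x | x <- xs]; last by rewrite big_map scaler_sumr.
by move=> _ /mapP[x /xsE xE ->]; exact: extremalZ.
Qed.

(** Minkowski's theorem for cones. If u is not extremal, choose v below u and
    not proportional to it, and leave K from u against v, at u1, then from v
    against u1, at v2. Then u is a nonnegative combination of u1 and v2, and
    both generate smaller faces, so induction on the dimension applies. *)
Theorem cone_extremal_sum u : K u -> extremal_sum u.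
Proof.
have [n] := ubnP (\dim (vspan (min_face K u))); elim: n u => // n IH u un Ku.
have [->|u0] := eqVneq u 0; first by exists [::]; rewrite ?big_nil.
have [ext|next] := pselect (extremal K u).
  by exists [:: u]; rewrite ?big_seq1 // => x; rewrite inE => /eqP ->.
have [v [Kv Kuv vu]] : exists v, [/\ K v, K (u - v) & forall a : R, v <> a *: u].
  apply: contrapT => H; apply: next; split=> // y Ky Kuy.
  apply: contrapT => /forallNP yu; apply: H; exists y; split=> // a; exact: yu.
have v0 : v != 0 by apply/eqP => v0; apply: (vu 0); rewrite scale0r.
have [s [s0 Ku1 smax su]] := cone_exit Ku Kv v0.
have s1 : 1 <= s by apply: smax; rewrite ?ler01 // scale1r.
have {}s0 : 0 < s by lra.
set u1 := u - s *: v in Ku1 su.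
have u10 : u1 != 0.
  apply/eqP => /eqP; rewrite subr_eq0 => /eqP uE; apply: (vu s^-1).
  by rewrite uE scalerA mulVf ?gt_eqF // scale1r.
have [t [t0 Kv2 _ tv]] := cone_exit Kv Ku1 u10.
set v2 := v - t *: u1 in Kv2 tv.
have Fu1 : min_face K u u1.
  apply: min_faceW => //; rewrite /u1 opprB addrC subrK.
  by apply: coneZ => //; exact: ltW.
have Fv : min_face K u v by apply: min_faceW.
have Fv2 : min_face K u v2.
  apply: min_faceW => //; rewrite /v2 opprB addrCA addrC.
  by apply: coneD => //; apply: coneZ.
(* Since u = u1 + s v and v = v2 + t u1. *)
have -> : u = (1 + s * t) *: u1 + s *: v2.
  by rewrite /v2 [s *: _]scalerBr scalerDl scale1r scalerA addrACA subrr addr0 /u1 subrK.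
have st0 : 0 <= 1 + s * t by rewrite addr_ge0 // mulr_ge0 // ltW.
apply: extremal_sumD; apply: extremal_sumZ => //; last 1 first.
- apply: IH => //; apply: leq_trans (min_face_dim_lt Ku Fv2 Fu1 tv) _; exact: un.
- apply: IH => //; apply: leq_trans (min_face_dim_lt Ku Fu1 Fv su) _; exact: un.
- exact: ltW.
Qed.

Lemma extremal_ray x : extremal K x -> extreme_ray K (min_face K x).
Proof.
move=> [x0 Kx H]; split; first exact: min_face_is_face.
have -> : vspan (min_face K x) = <[x]>%VS; last by rewrite dim_vline x0.
apply/eqP; rewrite eqEsubv; apply/andP; split; last first.
  by rewrite -memvE; apply: mem_vspan; exact: min_face_id.
have [_] := vspanP (min_face K x); apply=> y /(min_faceP _ Kx)[Ky [s s0 Ks]] /=.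
have [|a sy] := H (s *: y) _ Ks; first by apply: coneZ => //; exact: ltW.
apply/vlineP; exists (s^-1 * a); rewrite -scalerA -sy scalerA mulVf ?gt_eqF //.
by rewrite scale1r.
Qed.

End ClosedPointedCone.

(** * A Perron-Frobenius theorem *)

Section PerronFrobenius.
Variables (R : realType) (n : nat) (K : set 'cV[R]_n) (e : 'cV[R]_n) (A : 'M[R]_n).
Hypothesis Kconv : convex_cone K.
Hypothesis Kpt : pointed_cone K.
Hypothesis Kcl : forall x v, (forall s : R, 0 < s -> K (x + s *: v)) -> K x.
Hypothesis Ke : K e.
Hypothesis Kunit : forall x, exists2 s : R, 0 < s & K (x + s *: e).
Hypothesis AK : forall x, K x -> K (A *m x).

Local Notation coneD := (coneD Kconv).
Local Notation coneZ := (coneZ Kconv).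

Definition cone_int (x : 'cV[R]_n) := exists2 s : R, 0 < s & K (x - s *: e).

Let intD x y : cone_int x -> K y -> cone_int (x + y).
Proof. by move=> [s s0 xs] Ky; exists s => //; rewrite addrAC; apply: coneD. Qed.

Let intZ (a : R) x : 0 < a -> cone_int x -> cone_int (a *: x).
Proof.
move=> a0 [s s0 xs]; exists (a * s); first exact: mulr_gt0.
by rewrite -scalerA -scalerBr; apply: coneZ => //; exact: ltW.
Qed.

Let int_cone x : cone_int x -> K x.
Proof.
move=> [s s0 xs]; rewrite -(subrK (s *: e) x); apply: coneD => //.
by apply: coneZ => //; exact: ltW.
Qed.

Let int_e : cone_int e.
Proof.
exists (1 / 2); first by lra.
rewrite -{1}[e]scale1r -scalerBl; apply: coneZ => //; lra.
Qed.

(** The gauge of the order unit e is bounded by a weighted l1 norm of the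
    coordinates; this links the order to the topology. *)
Lemma order_unit_coord : exists m : 'I_n -> R,
  (forall i, 0 <= m i) /\ forall x : 'cV_n, K (x + (\sum_i `|x i 0| * m i) *: e).
Proof.
have /choice [m Hm] : forall i : 'I_n, exists s : R, [/\ 0 <= s,
    K (delta_mx i 0 + s *: e) & K (- delta_mx i 0 + s *: e)].
  move=> i; have [s s0 Ks] := Kunit (delta_mx i 0).
  have [t t0 Kt] := Kunit (- delta_mx i 0).
  exists (s + t); split; first by rewrite addr_ge0 // ltW.
    by rewrite scalerDl addrA; apply: coneD => //; apply: coneZ => //; exact: ltW.
  by rewrite [s + t]addrC scalerDl addrA; apply: coneD => //; apply: coneZ => //; exact: ltW.
exists m; split=> [i|x]; first by case: (Hm i).
have xE : x = \sum_i x i 0 *: delta_mx i 0.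
  by rewrite {1}[x]matrix_sum_delta; apply: eq_bigr => i _; rewrite big_ord1.
rewrite {1}xE scaler_suml -big_split /=.
apply: (big_ind K) => [|y z Ky Kz|i _]; [exact: (cone0 Kconv Ke)|exact: coneD|].
have [_ H1 H2] := Hm i; rewrite -scalerA.
have [x0|x0] := leP 0 (x i 0).
  by rewrite ger0_norm // -scalerDr; apply: coneZ.
rewrite ltr0_norm //.
have -> : x i 0 *: delta_mx i 0 + - x i 0 *: (m i *: e) =
    - x i 0 *: (- delta_mx i 0 + m i *: e).
  by rewrite scalerDr scalerN !scaleNr opprK.
by apply: coneZ => //; rewrite oppr_ge0 ltW.
Qed.

Local Notation ev mu := (map_mx (horner_eval (mu : R))).

(** Near r, the curve moves by less than any given multiple of e. *)
Lemma cone_poly_closed (w : 'cV[{poly R}]_n) (r : R) :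
  (forall mu, r < mu -> K (ev mu w)) -> K (ev r w).
Proof.
move=> Kw; have [m [m0 Km]] := order_unit_coord.
apply: (Kcl (v := e)) => s s0.
have /choice [q Hq] : forall i, exists q : {poly R},
    w i 0 - ((w i 0).[r])%:P = q * ('X - r%:P).
  by move=> i; apply/factor_theorem; rewrite rootE !hornerE subrr.
have /choice [B HB] : forall i, exists B : R, forall x, r <= x <= r + 1 -> `|(q i).[x]| <= B.
  by move=> i; have [B HB] := Num.Theory.poly_itv_bound (q i) r (r + 1); exists B.
have B0 i : 0 <= B i by apply: le_trans (normr_ge0 _) (HB i r _); rewrite lexx lerDl ler01.
set M := \sum_i B i * m i + 1.
have M0 : 0 < M by rewrite ltr_pwDr // sumr_ge0 // => i _; rewrite mulr_ge0.
pose h := Num.min 1 (s / M).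
have h0 : 0 < h by rewrite lt_min ltr01 divr_gt0.
have h1 : h <= 1 by rewrite ge_min lexx.
have hM : h * M <= s by rewrite -ler_pdivlMr // ge_min lexx orbT.
have := Km (ev r w - ev (r + h) w); set T := \sum_i _ => KT.
have Ts : T <= s.
  apply: le_trans hM; rewrite /M mulrDr mulr1.
  apply: (@le_trans _ _ (h * \sum_i B i * m i)); last by rewrite lerDl ltW.
  rewrite mulr_sumr; apply: ler_sum => i _; rewrite mulrA ler_wpM2r //.
  rewrite !mxE /horner_eval.
  have /(congr1 (fun p : {poly R} => p.[r + h])) := Hq i.
  rewrite !hornerE => wE.
  have -> : (w i 0).[r] - (w i 0).[r + h] = - (h * (q i).[r + h]).
    by rewrite -opprB wE; ring.
  rewrite normrN normrM (gtr0_norm h0) ler_wpM2l ?(ltW h0) // HB //.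
  by rewrite lerDl lerD2l h1 ltW.
have -> : ev r w + s *: e = ev (r + h) w +
    (ev r w - ev (r + h) w + T *: e) + (s - T) *: e.
  by rewrite scalerBl [ev (r + h) w + _]addrA subrKC -addrA subrKC.
apply: coneD; last by apply: coneZ => //; rewrite subr_ge0.
by apply: coneD => //; apply: Kw; rewrite ltrDl.
Qed.

(** The parameters mu such that mu - A is positive at some interior vector, as
    for a nonsingular M-matrix; its resolvent then preserves K (good_pos). *)
Let good (mu : R) := exists2 x, cone_int x & cone_int (mu *: x - A *m x).

Let good_up mu mu' : good mu -> mu <= mu' -> good mu'.
Proof.
move=> [x ix H] le; exists x => //.
have -> : mu' *: x - A *m x = (mu *: x - A *m x) + (mu' - mu) *: x.
  by rewrite addrAC -scalerDl subrKC.
by apply: intD => //; apply: coneZ; rewrite ?subr_ge0 //; exact: int_cone.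
Qed.

Let good_open mu : good mu -> exists2 s : R, 0 < s & good (mu - s).
Proof.
move=> [x ix [s s0 Ks]]; have [M M0 KM] := Kunit (- x).
exists (s / (2 * M)); first by rewrite divr_gt0 // mulr_gt0.
exists x => //; exists (s / 2); first by rewrite divr_gt0.
have -> : (mu - s / (2 * M)) *: x - A *m x - (s / 2) *: e =
    (mu *: x - A *m x - s *: e) + (s / (2 * M)) *: (- x + M *: e).
  have e1 : s / (2 * M) * M = s / 2 by field; rewrite gt_eqF.
  have e2 : s *: e = (s / 2) *: e + (s / 2) *: e by rewrite -scalerDl -splitr.
  rewrite scalerBl scalerDr scalerN scalerA e1 e2 opprD addrACA subrK.
  by congr (_ + _); rewrite addrAC.
by apply: coneD => //; apply: coneZ => //; rewrite divr_ge0 ?mulr_ge0 // ltW.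
Qed.

Hypothesis e0 : e != 0.

Let good_gt0 mu : good mu -> 0 < mu.
Proof.
move=> [x ix H]; rewrite ltNge; apply/negP => mu0.
have [s s0 Ks] : cone_int (mu *: x).
  by rewrite -(subrK (A *m x) (mu *: x)); apply: intD => //; exact/AK/int_cone.
have KNse : K (- (s *: e)).
  have -> : - (s *: e) = (mu *: x - s *: e) + (- mu) *: x.
    by rewrite addrAC scaleNr subrr add0r.
  by apply: coneD => //; apply: coneZ; rewrite ?oppr_ge0 //; exact: int_cone.
have /eqP := cone_opp Kpt (coneZ (ltW s0) Ke) KNse.
by rewrite scaler_eq0 gt_eqF // (negbTE e0).
Qed.

Let good_ex : exists mu, good mu.
Proof.
have [M M0 KM] := Kunit (- (A *m e)); exists (M + 1); exists e => //.
by rewrite scalerDl scale1r addrAC addrC [M *: e + _]addrC; apply: intD.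
Qed.

(** Push y into K by a multiple of x and withdraw: at the exit point w, the
    vector mu w is a sum of A w, of the given vector of K and of an interior
    vector, so w would be interior if the exit came before y. *)
Let good_pos mu y : good mu -> K (mu *: y - A *m y) -> K y.
Proof.
move=> gmu Ky; have mu0 := good_gt0 gmu; have [x ix H] := gmu.
have Kx := int_cone ix; have [s s0 Ks] := ix.
have [M M0 KM] := Kunit y; pose T := M / s.
have T0 : 0 < T by rewrite divr_gt0.
have KT : K (y + T *: x).
  have -> : y + T *: x = (y + M *: e) + T *: (x - s *: e).
    by rewrite scalerBr scalerA divfK ?gt_eqF // addrACA subrr addr0.
  by apply: coneD => //; apply: coneZ => //; exact: ltW.
have x0 : x != 0.
  apply/eqP => x0; move: Ks; rewrite x0 sub0r => /(cone_opp Kpt (coneZ (ltW s0) Ke)).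
  by apply/eqP; rewrite scaler_eq0 negb_or gt_eqF.
have [a [a0 Ka _ amax]] := cone_exit Kconv Kpt Kcl KT Kx x0.
have wE : y + T *: x - a *: x = y + (T - a) *: x by rewrite -addrA -scalerBl.
have [Ta|Ta] := leP (T - a) 0.
  have -> : y = (y + T *: x - a *: x) + (a - T) *: x.
    by rewrite wE -addrA -scalerDl -[a - T]opprB subrr scale0r addr0.
  by apply: coneD => //; apply: coneZ => //; rewrite -oppr_le0 opprB.
exfalso; set w := y + T *: x - a *: x in Ka amax wE.
have [t t0 Kt] : cone_int w.
  have -> : w = mu^-1 *: ((T - a) *: (mu *: x - A *m x) + (A *m w + (mu *: y - A *m y))).
    apply: (scalerI (lt0r_neq0 mu0)); rewrite scalerA divff ?gt_eqF // scale1r.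
    rewrite wE mulmxDr -scalemxAr scalerDr scalerBr !scalerA [mu * _]mulrC.
    rewrite [A *m y + _]addrC -[_ + _ + (mu *: y - _)]addrA [A *m y + _]addrC.
    by rewrite subrK addrA subrK addrC.
  apply: intZ; rewrite ?invr_gt0 //; apply: intD; first exact: intZ.
  by apply: coneD => //; exact: AK.
have [N N0 KN] := Kunit (- x).
apply: (amax (t / N)); first by rewrite divr_gt0.
have -> : w - (t / N) *: x = (w - t *: e) + (t / N) *: (- x + N *: e).
  rewrite scalerDr scalerN scalerA divfK ?gt_eqF //.
  by rewrite [RHS]addrACA addNr addr0.
by apply: coneD => //; apply: coneZ => //; rewrite divr_ge0 // ltW.
Qed.

Let good_det mu : good mu -> \det (mu%:M - A) != 0.
Proof.
move=> gmu; apply/negP; rewrite -det_tr => /det0P[v v0].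
move/(congr1 trmx); rewrite trmx_mul trmxK trmx0 mulmxBl mul_scalar_mx => vE.
have inK y : mu *: y - A *m y = 0 -> K y.
  by move=> yE; apply: (good_pos gmu); rewrite yE; exact: (cone0 Kconv Ke).
have : v^T = 0.
  apply: (cone_opp Kpt); apply: inK => //.
  by rewrite scalerN mulmxN -opprD vE oppr0.
by move/(congr1 trmx); rewrite trmxK trmx0 => /eqP; rewrite (negbTE v0).
Qed.

Let inf_good := inf [set mu | good mu].

Let good_gt_inf mu : inf_good < mu -> good mu.
Proof.
move=> H; have hi : has_inf [set mu | good mu].
  by split; [exact: good_ex | exists 0 => x /good_gt0 /ltW].
have [|nu gnu nulo] := @inf_adherent R _ (mu - inf_good) _ hi.
  by rewrite subr_gt0.
by apply: good_up gnu _; move: nulo; rewrite -/inf_good subrKC => /ltW.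
Qed.

Let good_inf : ~ good inf_good.
Proof.
move=> /good_open [s s0 gs].
have : inf_good <= inf_good - s.
  by apply: ge_inf => //; exists 0 => x /good_gt0 /ltW.
by rewrite lerDl oppr_ge0 leNgt s0.
Qed.

Local Notation cst M := (map_mx polyC M).

(** At inf_good the function chi vanishes, as otherwise inf_good would be good
    and goodness is an open condition. So v is an eigenvector there, unless it
    vanishes too; in that case divide v and chi by 'X - inf_good. *)
Let descent N (v : 'cV[{poly R}]_n) (chi : {poly R}) : (size chi <= N)%N ->
  'X *: v - (cst A) *m v = chi *: (cst e) ->
  (forall mu, inf_good < mu -> K (ev mu v) /\ 0 < chi.[mu]) ->
  exists z, [/\ K z, z != 0 & exists a : R, A *m z = a *: z].
Proof.
elim: N v chi => [|N IH] v chi sN vE H.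
  move: sN; rewrite leqn0 size_poly_eq0 => /eqP chi0.
  have [_] := H (inf_good + 1) (ltr_pwDr ltr01 (lexx _)).
  by rewrite chi0 horner0 ltxx.
have evE mu : mu *: ev mu v - A *m ev mu v = chi.[mu] *: e.
  have /(congr1 (fun M : 'cV[{poly R}]_n => ev mu M)) := vE.
  rewrite map_mxB map_mxM !map_mxZ /= /horner_eval hornerX.
  have -> : map_mx (horner_eval mu) (cst A) = A.
    by apply/matrixP => i j; rewrite !mxE /horner_eval hornerC.
  have -> // : map_mx (horner_eval mu) (cst e) = e.
  by apply/matrixP => i j; rewrite !mxE /horner_eval hornerC.
have Kv : K (ev inf_good v) by apply: cone_poly_closed => mu /H[].
have chi_ge0 : 0 <= chi.[inf_good].
  apply: (@poly_ge0_closed _ _ _ (inf_good + 1)); first by rewrite ltrDl.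
  by move=> t /andP[/H[_ /ltW]].
have chi0 : chi.[inf_good] = 0.
  apply/eqP; rewrite eq_le chi_ge0 andbT leNgt; apply/negP => c0.
  (* If chi were positive at inf_good, v + s e would show that inf_good is good. *)
  have [M M0 KM] := Kunit (inf_good *: e - A *m e).
  pose s := chi.[inf_good] / (2 * M).
  have s0 : 0 < s by rewrite divr_gt0 // mulr_gt0.
  apply: good_inf; exists (ev inf_good v + s *: e).
    by rewrite addrC; apply: intD => //; exact: intZ.
  have -> : inf_good *: (ev inf_good v + s *: e) - A *m (ev inf_good v + s *: e) =
      (chi.[inf_good] / 2) *: e + s *: (inf_good *: e - A *m e + M *: e).
    rewrite mulmxDr -scalemxAr scalerDr opprD addrACA evE.
    have -> : inf_good *: (s *: e) = s *: (inf_good *: e) by rewrite !scalerA mulrC.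
    rewrite -scalerBr.
    rewrite [in RHS]scalerDr [s *: (M *: e)]scalerA.
    have -> : s * M = chi.[inf_good] / 2 by rewrite /s; field; rewrite gt_eqF.
    by rewrite [in RHS]addrCA -scalerDl -splitr addrC.
  by apply: intD; [apply: intZ => //; rewrite divr_gt0 | apply: coneZ => //; exact: ltW].
have [v0|v0] := eqVneq (ev inf_good v) 0; last first.
  exists (ev inf_good v); split=> //; exists inf_good; apply/esym/eqP.
  by rewrite -subr_eq0 evE chi0 scale0r.
have /choice [w wE] : forall i, exists w : {poly R}, v i 0 = w * ('X - inf_good%:P).
  move=> i; apply/factor_theorem; rewrite rootE.
  by have /matrixP/(_ i 0) := v0; rewrite !mxE => /eqP.
have /factor_theorem [chi' chiE] : root chi inf_good by rewrite rootE chi0.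
pose v' : 'cV[{poly R}]_n := \col_i w i.
have vv' : v = ('X - inf_good%:P) *: v'.
  by apply/matrixP => i j; rewrite !mxE (ord1 j) wE mulrC.
apply: (IH v' chi').
- have chi'0 : chi' != 0.
    apply/eqP => c0; have [_] := H (inf_good + 1) (ltr_pwDr ltr01 (lexx _)).
    by rewrite chiE c0 mul0r horner0 ltxx.
  by move: sN; rewrite chiE size_Mmonic ?monicXsubC // size_XsubC addn2.
- have X0 : 'X - inf_good%:P != 0 :> {poly R} by rewrite polyXsubC_eq0.
  suff /matrixP E : ('X - inf_good%:P) *: ('X *: v' - cst A *m v') =
      ('X - inf_good%:P) *: (chi' *: cst e).
    apply/matrixP => i j; apply: (mulfI X0).
    by have := E i j; rewrite [LHS]mxE [RHS]mxE.
  rewrite scalerBr.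
  have -> : ('X - inf_good%:P) *: ('X *: v') = 'X *: v.
    by rewrite vv' !scalerA mulrC.
  rewrite scalemxAr -vv' vE.
  by rewrite chiE mulrC scalerA.
- move=> mu mur; have [Kmu cmu] := H mu mur.
  have mu0 : 0 < mu - inf_good by rewrite subr_gt0.
  have -> : ev mu v' = (mu - inf_good)^-1 *: ev mu v.
    apply/matrixP => i j; rewrite !mxE /horner_eval (ord1 j) wE hornerM.
    by rewrite hornerXsubC mulrCA mulVf ?mulr1 // gt_eqF.
  split; first by apply: coneZ => //; rewrite invr_ge0 ltW.
  by move: cmu; rewrite chiE !hornerE pmulr_lgt0.
Qed.

(** The curve is chi adj (mu - A) e, where chi is the characteristic
    polynomial. The factor chi makes the right-hand side chi^2 e nonnegative,
    so that no information on the sign of chi is required. *)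
Theorem perron_frobenius : exists z, [/\ K z, z != 0 & exists a : R, A *m z = a *: z].
Proof.
pose chi := char_poly A.
pose v := chi *: (\adj (char_poly_mx A) *m (cst e)).
have chiE mu : chi.[mu] = \det (mu%:M - A).
  rewrite -/(horner_eval mu chi) /chi /char_poly -det_map_mx; congr (\det _).
  apply/matrixP => i j; rewrite !mxE /= /horner_eval !hornerE.
  by case: (i == j); rewrite ?mulr1n ?mulr0n ?hornerE.
have vE : 'X *: v - (cst A) *m v = chi ^+ 2 *: (cst e).
  have -> : 'X *: v - (cst A) *m v = char_poly_mx A *m v.
    by rewrite mulmxBl mul_scalar_mx.
  rewrite /v -scalemxAr mulmxA mul_mx_adj mul_scalar_mx scalerA expr2.
  by [].
apply: (descent (leqnn _) vE) => mu /good_gt_inf gmu.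
have c0 : chi.[mu] != 0 by rewrite chiE good_det.
split; last by rewrite horner_exp exprn_even_gt0 //= .
have c20 : 0 < (chi ^+ 2).[mu] by rewrite horner_exp exprn_even_gt0.
have -> : ev mu v = (chi ^+ 2).[mu] *: ((chi ^+ 2).[mu]^-1 *: ev mu v).
  by rewrite scalerA divff ?gt_eqF // scale1r.
apply: coneZ; first exact: ltW.
apply: (good_pos gmu).
have /(congr1 (fun M : 'cV[{poly R}]_n => ev mu M)) := vE.
rewrite map_mxB map_mxM !map_mxZ /= /horner_eval hornerX -/(horner_eval mu).
have -> : map_mx (horner_eval mu) (cst A) = A.
  by apply/matrixP => i j; rewrite !mxE /horner_eval hornerC.
have -> : map_mx (horner_eval mu) (cst e) = e.
  by apply/matrixP => i j; rewrite !mxE /horner_eval hornerC.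
move=> evE; rewrite -scalemxAr scalerA mulrC -scalerA -scalerBr evE scalerA.
by rewrite mulVf ?gt_eqF // scale1r.
Qed.

End PerronFrobenius.

(** * Rank one, and rigidity of the polynomial given the cone *)

Section Multiplicity.
Variables (R : realType) (V : vectType R) (d : nat) (p : V -> R) (e : V).
Hypothesis he : hyperbolic d p e.
Let hp : homog_polyfun d p. Proof. by case: he. Qed.
Let e0 : 0 < p e. Proof. by case: he. Qed.

Lemma mup0P (P : {poly R}) : P != 0 ->
  (forall k, (k < mup 0 P)%N -> P`_k = 0) /\ P`_(mup 0 P) != 0.
Proof.
move=> P0; have X0 : 'X - (0 : R)%:P = 'X by rewrite subr0.
split=> [k kP|].
  have := mup_geq 0 (mup 0 P) P0; rewrite leqnn X0 => /esym/dvdpP[Q ->].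
  by rewrite coefMXn kP.
have := mup_leq 0 (mup 0 P) P0; rewrite leqnn X0 => /esym.
have := mup_geq 0 (mup 0 P) P0; rewrite leqnn X0 => /esym/dvdpP[Q].
move: (mup 0 P) => m QE; apply: contraNneq => Pm.
have Q0 : Q`_0 = 0 by move: Pm; rewrite {1}QE coefMXn ltnn subnn.
have /factor_theorem [S SE] : root Q 0 by rewrite rootE horner_coef0 Q0.
by rewrite QE SE X0 exprS -mulrA dvdp_mull // dvdpp.
Qed.

Lemma hypmultP x : [/\ (hypmult p e x <= d)%N,
  forall k, (k < hypmult p e x)%N -> (line_poly p x e)`_k = 0
  & (line_poly p x e)`_(hypmult p e x) != 0].
Proof.
have P0 : line_poly p (- x) e != 0.
  apply/eqP => /(congr1 (fun q : {poly R} => q`_d)); rewrite (line_coef_lead hp) coef0.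
  by move/eqP; rewrite gt_eqF.
have sgn k : (line_poly p (- x) e)`_k = 0 <-> (line_poly p x e)`_k = 0.
  have := line_coefZ hp (- 1) e x k; rewrite scaleN1r => E.
  have [s1 s2] : (- 1 : R) ^+ k != 0 /\ (- 1 : R) ^+ d != 0 by rewrite !signr_eq0.
  split=> H; first by apply: (mulfI s2); rewrite -E H mul0r mulr0.
  by apply: (mulIf s1); rewrite E H mul0r mulr0.
(* The multiplicity is defined at - x, the coefficients are taken at x. *)
have [Z NZ] := mup0P P0; split.
- rewrite leqNgt; apply/negP => /Z /eqP; rewrite (line_coef_lead hp) gt_eqF //.
- by move=> k /Z /sgn.
- by apply: contra NZ => /eqP/sgn/eqP.
Qed.

(** For interior y, mult_mono bounds the multiplicity along y from below by the
    one along e, which is d - 1. So u |-> p (x + u y) is a u^(d-1) + p(y) u^d,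
    and reversing it makes s |-> p (y + s x) affine. A general y becomes
    interior after adding a large multiple of e, and both sides are polynomial
    in that multiple. *)
Lemma hyprank1_affine x : hypcone p e x -> hyprank d p e x = 1%N ->
  forall y (s : R), p (y + s *: x) = p y + s * (p (y + x) - p y).
Proof.
move=> ex rx; have [md Z _] := hypmultP x; rewrite /hyprank in rx.
have mE : hypmult p e x = d.-1 by lia.
have d0 : (0 < d)%N by lia.
rewrite mE in Z.
have int_affine y s : hypint p e y -> p (y + s *: x) = p y + s * (p (y + x) - p y).
  move=> ey; have [N N0 eN] := hypint_unit he (- y).
  have Zy k : (k < d.-1)%N -> (line_poly p x y)`_k = 0.
    apply: (mult_mono (x' := x) (y' := N *: e) he) => //.
    - by rewrite subrr; exact: (hypcone0 he).
    - by rewrite addrC; exact: (hypint_hypcone he).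
    - by move=> j jd; rewrite (line_coef_dirZ hp) Z ?mulr0.
  set a := (line_poly p x y)`_d.-1.
  have H : line_poly p y x = (p y)%:P + a *: 'X.
    apply: (@poly_ext_gt _ _ _ 0) => t t0.
    rewrite (line_polyE _ _ _ hp) !hornerE.
    have -> : y + t *: x = t *: (x + t^-1 *: y).
      by rewrite scalerDr scalerA divff ?gt_eqF // scale1r addrC.
    rewrite (p_homog hp) -(line_polyE _ _ _ hp).
    have -> : line_poly p x y = a *: 'X^(d.-1) + p y *: 'X^d.
      apply/polyP => k; rewrite coefD !coefZ !coefXn.
      have [kd|kd|->] := ltngtP k d.-1.
      + by rewrite Zy // mulr0 add0r (_ : (k == d) = false) ?mulr0 //; lia.
      + rewrite mulr0 add0r; have [->|kNd] := eqVneq k d.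
          by rewrite mulr1 (line_coef_lead hp).
        rewrite mulr0 nth_default // (line_poly_line hp).
        by apply: leq_trans (proj1 (line_size hp _ _)) _; lia.
      + by rewrite mulr1 (_ : (d.-1 == d) = false) ?mulr0 ?addr0 //; lia.
    rewrite !hornerE -[in t ^+ d](prednK d0) -[in t^-1 ^+ d](prednK d0) !exprS.
    by rewrite !exprVn; field; rewrite expf_neq0 gt_eqF.
  have Hx u : p (y + u *: x) = p y + a * u.
    by rewrite -(line_polyE _ _ _ hp) H !hornerE.
  by rewrite Hx -[X in p (y + X)]scale1r Hx; ring.
move=> y s; have [N N0 eN] := hypint_unit he y.
have := @poly_ext_gt _ (line_poly p (y + s *: x) e)
  (line_poly p y e + s *: (line_poly p (y + x) e - line_poly p y e)) N.
move=> /(_ _)/(congr1 (fun q : {poly R} => q.[0])).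
rewrite !hornerE !(line_polyE _ _ _ hp) !scale0r !addr0; apply=> t Nt.
rewrite !hornerE !(line_polyE _ _ _ hp) addrAC [y + x + _]addrAC; apply: int_affine.
have -> : y + t *: e = (y + N *: e) + (t - N) *: e by rewrite -addrA -scalerDl subrKC.
by apply: hypintDe => //; rewrite subr_ge0 ltW.
Qed.

Lemma dirderiv_affine x k : (forall y (s : R), p (y + s *: x) = p y + s * (p (y + x) - p y)) ->
  forall y (s : R), dirderiv e k p (y + s *: x) =
    dirderiv e k p y + s * (dirderiv e k p (y + x) - dirderiv e k p y).
Proof.
move=> H y s; rewrite !(dirderiv_horner hp).
have -> : line_poly p (y + s *: x) e =
    line_poly p y e + s *: (line_poly p (y + x) e - line_poly p y e).
  apply: poly_ext => t; rewrite !hornerE !(line_polyE _ _ _ hp).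
  by rewrite addrAC H [y + x + _]addrAC.
by rewrite derivnD derivnZ derivnB !hornerE.
Qed.

End Multiplicity.

Section Rigidity.
Variables (R : realType) (W : vectType R) (d : nat) (q : W -> R) (e : W).
Hypothesis he : hyperbolic d q e.
Let hq : homog_polyfun d q. Proof. by case: he. Qed.
Local Notation Q := (hypcone q e).
Local Notation I := (hypint q e).
Hypothesis Qpt : pointed_cone Q.
Variables (B : {linear W -> W}) (a : R).
Hypothesis a0 : 0 < a.
Hypothesis Be : B e = a *: e.
Hypothesis BQ : forall y, Q (B y) <-> Q y.
Let affine x := forall y (s : R), q (y + s *: x) = q y + s * (q (y + x) - q y).
Hypothesis ext_affine : forall x, extremal Q x -> affine x /\ affine (B x).

(** With y as the direction, y + s x + t y is a multiple of a point of the
    segment from y to y + s x, on which q is affine and positive at both ends. *)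
Lemma affine_int x y (s : R) : affine x -> I y ->
  0 < q y + s * (q (y + x) - q y) -> I (y + s *: x).
Proof.
move=> ax iy pos; rewrite -(hypint_dirE he iy) => t t0.
have y0 := hypint_gt0 he iy; have t1 : 0 < 1 + t by lra.
have -> : y + s *: x + t *: y = (1 + t) *: (y + (s / (1 + t)) *: x).
  rewrite scalerDr scalerA mulrCA divff ?gt_eqF // mulr1 scalerDl scale1r.
  by rewrite addrAC.
rewrite (p_homog hq) ax gt_eqF // mulr_gt0 ?exprn_gt0 //.
have -> : q y + s / (1 + t) * (q (y + x) - q y) =
  (t * q y + (q y + s * (q (y + x) - q y))) / (1 + t) by field; rewrite gt_eqF.
by rewrite divr_gt0 // ltr_wpDl // mulr_ge0 // ltW.
Qed.

(** With a nonpositive slope, q would stay positive on the whole ray directed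
    by - x, which would then lie in Q. *)
Lemma extremal_slope_gt0 x y : extremal Q x -> I y -> 0 < q (y + x) - q y.
Proof.
move=> xE iy; have [ax _] := ext_affine xE; have y0 := hypint_gt0 he iy.
have [x0 Qx _] := xE; rewrite ltNge; apply/negP => b0.
have H s : 0 < s -> Q (y - s *: x).
  move=> s0; apply: (hypint_hypcone he); rewrite -scaleNr; apply: affine_int => //.
  by rewrite ltr_pwDl // mulNr oppr_ge0 mulr_ge0_le0 // ltW.
have /(cone_opp Qpt Qx) : Q (- x).
  apply: (hypcone_closed he (v := y)) => s s0.
  have -> : - x + s *: y = s *: (y - s^-1 *: x).
    by rewrite scalerBr scalerA divff ?gt_eqF // scale1r addrC.
  by apply: (hypconeZ he); [exact: ltW | apply: H; rewrite invr_gt0].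
by move/eqP; rewrite (negbTE x0).
Qed.

Lemma hypcone_ge0 y : Q y -> 0 <= q y.
Proof.
move=> Qy; have := hypcone_coef_ge0 he (hypint_dir he) Qy 0%N.
by rewrite -horner_coef0 (line_polyE _ _ _ hq) scale0r addr0.
Qed.

(** B also reflects the interior, because B e is a positive multiple of e. *)
Lemma boundary_image w : Q w -> q w = 0 -> q (B w) = 0.
Proof.
move=> Qw qw; apply/eqP/negPn/negP => qBw.
have Bi : I (B w).
  apply: (hypcone_gt0_int he); first exact/BQ.
  by rewrite lt_def qBw hypcone_ge0 //; exact/BQ.
have /(hypcone_interior he)[s s0 Qs] := Bi.
have /(hypint_gt0 he) : I w.
  apply/(hypcone_interior he); exists (s / a); first exact: divr_gt0.
  by apply/BQ; rewrite linearB linearZ /= Be scalerA divfK ?gt_eqF.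
by rewrite qw ltxx.
Qed.

(** On the line y + s x, the functions q and q (B _) are affine and vanish at
    the same r, the parameter at which the line leaves Q. *)
Lemma extremal_ratio x y (s : R) : extremal Q x -> I y ->
  q (B (y + s *: x)) * q y = q (B y) * q (y + s *: x).
Proof.
move=> xE iy; have [ax aBx] := ext_affine xE; have y0 := hypint_gt0 he iy.
have b0 := extremal_slope_gt0 xE iy.
rewrite linearD linearZ /= ax aBx.
set b := q (y + x) - q y in b0 *; set b' := q (B y + B x) - q (B y).
(* The zero of the affine function q on the line. *)
pose r := - (q y / b).
have rb : q y + r * b = 0 by rewrite /r mulNr divfK ?subrr // gt_eqF.
have Qw : Q (y + r *: x).
  rewrite -(hypcone_dirE he iy); apply/(hypcone_int (hyperbolic_int he iy)) => t t0.
  have t1 : 0 < 1 + t by lra.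
  have -> : y + r *: x + t *: y = (1 + t) *: (y + (r / (1 + t)) *: x).
    rewrite scalerDr scalerA mulrCA divff ?gt_eqF // mulr1 scalerDl scale1r.
    by rewrite addrAC.
  apply: (hypintZ (hyperbolic_int he iy)) => //; rewrite (hypint_dirE he iy).
  apply: affine_int => //; rewrite -/b.
  have -> : q y + r / (1 + t) * b = (t * q y + (q y + r * b)) / (1 + t).
    by field; rewrite gt_eqF.
  by rewrite rb addr0 divr_gt0 // mulr_gt0.
have := boundary_image Qw; rewrite ax -/b rb => /(_ erefl).
rewrite linearD linearZ /= aBx -/b' => rb'.
have -> : b' = q (B y) * b / q y.
  apply: (mulfI (_ : r != 0)); first by rewrite oppr_eq0 mulf_neq0 ?invr_eq0 ?gt_eqF.
  have -> : r * b' = - q (B y) by apply/eqP; rewrite -addr_eq0 addrC rb'.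
  by rewrite /r; field; rewrite !gt_eqF.
by field; rewrite gt_eqF.
Qed.

Lemma cone_ratio u y : Q u -> I y -> q (B (y + u)) * q y = q (B y) * q (y + u).
Proof.
move=> Qu; have [xs xsE ->] :=
  cone_extremal_sum (hypcone_convex he) Qpt (hypcone_closed he) Qu.
elim: xs xsE y => [|x xs IH] xsE y iy; first by rewrite big_nil addr0 mulrC.
have xE : extremal Q x by apply: xsE; rewrite mem_head.
have [x0 Qx _] := xE.
have iyx : I (y + x) by rewrite addrC; exact: (hypcone_intD he).
have yx0 := hypint_gt0 he iyx.
rewrite big_cons addrA.
have E1 := IH (fun v vxs => xsE v (mem_behead (s := x :: xs) vxs)) _ iyx.
have := extremal_ratio 1 xE iy; rewrite scale1r => E2.
apply: (mulIf (lt0r_neq0 yx0)).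
by rewrite mulrAC E1 mulrAC E2; ring.
Qed.

(** Compare the ratios at y and at e through their common successor y + e. The
    identity is stated on lines directed by e so that it can be differentiated. *)
Theorem pullback_proportional : exists2 kappa : R, 0 < kappa &
  forall y t, q (B y + (t * a) *: e) = kappa * q (y + t *: e).
Proof.
have e0 : 0 < q e by case: he.
have Bey t y : B (y + t *: e) = B y + (t * a) *: e.
  by rewrite linearD linearZ /= Be scalerA.
exists (a ^+ d); first exact: exprn_gt0.
have int y : I y -> q (B y) = a ^+ d * q y.
  move=> iy; have y0 := hypint_gt0 he iy.
  have E1 := cone_ratio (hypcone_dir he) iy.
  have E2 := cone_ratio (hypint_hypcone he iy) (hypint_dir he).
  rewrite addrC Be (p_homog hq) in E2.
  have ye0 : q (y + e) != 0.
    by apply: (hypintD_neq0 he) => //; exact: (hypint_dir he).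
  apply: (mulIf ye0); rewrite -E1; apply: (mulIf (lt0r_neq0 e0)).
  by rewrite mulrAC E2; ring.
move=> y; have [N N0 yN] := hypint_unit he y.
have : line_poly q (B y) (a *: e) = a ^+ d *: line_poly q y e.
  apply: (@poly_ext_gt _ _ _ N) => t Nt.
  rewrite hornerZ !(line_polyE _ _ _ hq) scalerA -Bey int //.
  have -> : y + t *: e = (y + N *: e) + (t - N) *: e by rewrite -addrA -scalerDl subrKC.
  by apply: hypintDe => //; rewrite subr_ge0 ltW.
move=> H t; have /(congr1 (fun P : {poly R} => P.[t])) := H.
by rewrite hornerZ !(line_polyE _ _ _ hq) scalerA.
Qed.

Theorem derivative_cone_invariant k y :
  hypcone (dirderiv e k q) e (B y) <-> hypcone (dirderiv e k q) e y.
Proof.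
have [kappa kappa0 H] := pullback_proportional.
have D u : dirderiv e k q (B u) * a ^+ k = kappa * dirderiv e k q u.
  rewrite !(dirderivE hq) mulrnAr mulrnAl; congr (_ *+ _).
  rewrite mulrC -(line_coef_dirZ hq) -coefZ.
  have -> // : line_poly q (B u) (a *: e) = kappa *: line_poly q u e.
  apply: poly_ext => t; rewrite hornerZ !(line_polyE _ _ _ hq) scalerA; exact: H.
have D0 u : dirderiv e k q (B u) = 0 <-> dirderiv e k q u = 0.
  split=> E; have := D u; rewrite E.
    by rewrite mul0r => /esym/eqP; rewrite mulf_eq0 gt_eqF //= => /eqP.
  by rewrite mulr0 => /eqP; rewrite mulf_eq0 expf_eq0 (gt_eqF a0) andbF orbF => /eqP.
have Bt t : B ((t / a) *: e - y) = t *: e - B y.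
  by rewrite linearB linearZ /= Be scalerA divfK // gt_eqF.
split=> Q' t Dt.
  have := Q' (t * a); rewrite -Bt mulfK ?gt_eqF // => /(_ (proj2 (D0 _) Dt)).
  by rewrite pmulr_lge0.
have := Q' (t / a); rewrite -Bt in Dt => /(_ (proj1 (D0 _) Dt)).
by rewrite pmulr_lge0 // invr_gt0.
Qed.

End Rigidity.

(** * Faces and automorphisms of hyperbolicity cones *)

Section FaceOfHyperbolicityCone.
Variables (R : realType) (V : vectType R) (d : nat) (p : V -> R) (e z : V).
Hypothesis he : hyperbolic d p e.
Hypothesis Kpt : pointed_cone (hypcone p e).
Local Notation K := (hypcone p e).
Hypothesis Kz : K z.
Let hp : homog_polyfun d p. Proof. by case: he. Qed.
Let Kconv := hypcone_convex he.
Let m := hypmult p e z.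
Let F := min_face K z.
Let L := vspan F.
Let pm := dirderiv e m p.

Let md : (m <= d)%N. Proof. by case: (hypmultP he z). Qed.

Let hpm : hyperbolic (d - m) pm e. Proof. exact: hyperbolic_dirderiv. Qed.

(** Since z - s u lies in the cone for some s > 0, the multiplicity at u is at
    least the one at z. *)
Let face_coef0 u k : F u -> (k < m)%N -> (line_poly p u e)`_k = 0.
Proof.
move=> /(min_faceP Kconv _ Kz)[Ku [s s0 Ks]] km.
have [_ Z _] := hypmultP he z.
have Ee := hypint_dir he.
have := mult_mono (x := s *: u) (x' := z) (y := e) (y' := e) (m := m) he.
move=> /(_ (hypconeZ he (ltW s0) Ku) Ks Ee).
rewrite subrr => /(_ (hypcone0 he) Z k km) H.
have := line_coefZ hp s e u k; rewrite H mul0r => /esym/eqP.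
by rewrite mulf_eq0 expf_eq0 (gt_eqF s0) andbF => /eqP.
Qed.

(** A vector of the span is a - b with a and b in F, and the coefficient is
    polynomial along a + t b, which stays in F for t >= 0. *)
Let span_coef0 u k : u \in L -> (k < m)%N -> (line_poly p u e)`_k = 0.
Proof.
move=> /(min_face_span Kconv Kz)[a [b [Fa Fb ->]]] km.
have kd : (k <= d)%N by rewrite ltnW // (leq_trans km).
have D0 v : dirderiv e k p v = 0 <-> (line_poly p v e)`_k = 0.
  rewrite (dirderivE hp); split=> [/eqP|->]; last by rewrite mul0rn.
  by rewrite mulrn_eq0 gtn_eqF ?fact_gt0 //= => /eqP.
apply/D0; have hk := homog_polyfun_dirderiv hp e kd.
have -> : a - b = a + (- 1) *: b by rewrite scaleN1r.
rewrite -(line_polyE _ _ _ hk) (_ : line_poly _ a b = 0) ?horner0 //.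
apply: (@poly_ext_gt _ _ _ 0) => t t0; rewrite horner0 (line_polyE _ _ _ hk).
apply/D0/face_coef0 => //; rewrite -[a]scale1r.
by have [_ Fc _ _] := min_face_is_face Kconv Kz; apply: Fc => //; exact: ltW.
Qed.

Let pm_coef u k : (line_poly pm u e)`_k =
  (line_poly p u e)`_(m + k) *+ (m + k) ^_ m.
Proof. by rewrite /pm (line_dirderiv hp) // coef_derivn. Qed.

Let cone_sub_derivative u : K u -> hypcone pm e u.
Proof.
move=> Ku; apply: (coef_ge0_hypcone hpm) => k; rewrite pm_coef mulrn_wge0 //.
exact: (hypcone_coef_ge0 he (hypint_dir he)).
Qed.

Let pm_int : hypint pm e z.
Proof.
apply: (hypcone_gt0_int hpm); first exact: cone_sub_derivative.
have [_ _ nz] := hypmultP he z.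
rewrite /pm (dirderivE hp) pmulrn_lgt0 ?fact_gt0 // lt_def nz.
exact: (hypcone_coef_ge0 he (hypint_dir he)).
Qed.

Lemma hyperbolic_face_dir : hyperbolic (d - m) pm z.
Proof. exact: (hyperbolic_int hpm). Qed.

(** On the span of F, the coefficients of order less than m vanish and the
    others are, up to positive factors, those of the derivative of order m. So
    both cones are given by the same sign conditions. *)
Lemma faceE u : F u <-> u \in L /\ hypcone pm z u.
Proof.
rewrite (hypcone_dirE hpm pm_int); split=> [Fu|[uL Pu]].
  split; first exact: mem_vspan.
  by apply: cone_sub_derivative; exact: (min_face_sub Kconv Kz Fu).
apply: (min_face_cap Kconv Kz uL); apply: (coef_ge0_hypcone he) => k.
have [km|mk] := ltnP k m; first by rewrite span_coef0.
have := hypcone_coef_ge0 hpm (hypint_dir hpm) Pu (k - m).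
rewrite pm_coef subnKC // le_eqVlt eq_sym mulrn_eq0 => /orP[/orP[|/eqP ->]|] //.
  by rewrite eqn0Ngt ffact_gt0 mk.
by move/ltW; rewrite pmulrn_lge0 // ffact_gt0.
Qed.

Lemma extremal_face u : F u -> (forall v, F v -> F (u - v) -> exists a : R, v = a *: u) ->
  u != 0 -> extremal K u.
Proof.
move=> Fu H u0; have Ku := min_face_sub Kconv Kz Fu; split=> // v Kv Kuv.
have [_ _ _ Fext] := min_face_is_face Kconv Kz.
have [|Fuv Fv] := Fext (u - v) v Kuv Kv; first by rewrite subrK.
exact: H.
Qed.

End FaceOfHyperbolicityCone.

Lemma ROG_extremal_affine (R : realType) (V : vectType R) (d : nat) (p : V -> R)
    (e x : V) : hyperbolic d p e -> ROG d p e -> extremal (hypcone p e) x ->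
  forall y (s : R), p (y + s *: x) = p y + s * (p (y + x) - p y).
Proof.
move=> he [Kpt rog] xE; have [_ Kx _] := xE.
have [x' [Kx' rx' FE]] := rog _ (extremal_ray (hypcone_convex he) xE).
have [c c0 <-] : [set a *: x' | a in [set a : R | 0 <= a]] x.
  by rewrite -FE; exact: min_face_id.
move=> y s; have H := hyprank1_affine he Kx' rx'.
by rewrite scalerA !H; ring.
Qed.

Section Automorphism.
Variables (R : realType) (n d : nat) (p : 'cV[R]_n -> R) (e : 'cV[R]_n) (A : 'M[R]_n).
Hypothesis he : hyperbolic d p e.
Hypothesis rog : ROG d p e.
Hypothesis autA : cone_aut (hypcone p e) A.
Local Notation K := (hypcone p e).
Let Kconv := hypcone_convex he.
Let Kpt : pointed_cone K. Proof. by case: rog. Qed.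

Lemma mulmxI_unit (x y : 'cV[R]_n) : A *m x = A *m y -> x = y.
Proof.
have [uA _] := autA => Axy.
by rewrite -[x](mulKmx uA) Axy mulKmx.
Qed.

Lemma autE x : K (A *m x) <-> K x.
Proof.
have [uA AK] := autA; split=> [|Kx].
  by rewrite -{1}AK => -[y Ky /mulmxI_unit <-].
by rewrite -AK; exists x.
Qed.

Lemma aut_inv (x : 'cV[R]_n) : A *m (invmx A *m x) = x.
Proof. by have [uA _] := autA; rewrite mulKVmx. Qed.

Lemma aut_extremal x : extremal K x -> extremal K (A *m x).
Proof.
move=> [x0 Kx H]; split; last 1 first.
- move=> y; rewrite -(aut_inv y) => /autE Ky; rewrite -mulmxBr => /autE Kxy.
  have [a yE] := H _ Ky Kxy; exists a; by rewrite yE scalemxAr.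
- by apply: contra x0 => /eqP Ax; apply/eqP/mulmxI_unit; rewrite Ax mulmx0.
- exact/autE.
Qed.

Lemma hyperbolic_eigenvector : (0 < n)%N -> exists z, K z /\ eigenvector A z.
Proof.
move=> n0; have [|||z [Kz z0 [a Az]]] := perron_frobenius (e := e) (A := A)
  Kconv Kpt (hypcone_closed he) (hypcone_dir he) _ _ _.
- move=> x; have [s s0 xs] := hypint_unit he x.
  by exists s => //; exact: (hypint_hypcone he).
- by move=> x /autE.
- apply/eqP => e0.
  have KT x : K x.
    have [s _ /(hypint_hypcone he)] := hypint_unit he x.
    by rewrite e0 scaler0 addr0.
  have /matrixP/(_ (Ordinal n0) 0) : const_mx 1 = 0 :> 'cV[R]_n.
    exact: (cone_opp Kpt).
  by rewrite !mxE => /eqP; rewrite oner_eq0.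
by exists z; split=> //; split=> //; exists a.
Qed.

Variable z : 'cV[R]_n.
Hypothesis Kz : K z.
Hypothesis z0 : z != 0.
Variable a : R.
Hypothesis Az : A *m z = a *: z.
Let F := min_face K z.
Let L := vspan F.
Let m := hypmult p e z.
Let pm := dirderiv e m p.

Lemma eigenvalue_gt0 : 0 < a.
Proof.
rewrite ltNge; apply/negP => a0; have /negP := z0; apply.
apply/eqP/mulmxI_unit; rewrite mulmx0 Az; apply: (cone_opp Kpt).
  by rewrite -Az; exact/autE.
by rewrite -scaleNr; apply: (hypconeZ he) => //; rewrite oppr_ge0.
Qed.

Lemma aut_face x : F (A *m x) <-> F x.
Proof.
have a0 := eigenvalue_gt0.
rewrite /F !(min_faceP Kconv) //; split=> -[Kx [s s0 Ks]]; split.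
- exact/autE.
- exists (a * s); first exact: mulr_gt0.
  apply/autE; rewrite mulmxBr Az -scalemxAr -scalerA -scalerBr.
  by apply: (hypconeZ he) => //; exact: ltW.
- exact/autE.
- exists (s / a); first exact: divr_gt0.
  have -> : z - (s / a) *: (A *m x) = a^-1 *: (A *m (z - s *: x)).
    rewrite mulmxBr Az -scalemxAr scalerBr !scalerA mulVf ?gt_eqF // scale1r.
    by rewrite mulrC.
  by apply: (hypconeZ he); [rewrite invr_ge0 ltW | exact/autE].
Qed.

Lemma aut_span (x : 'cV[R]_n) : A *m x \in L <-> x \in L.
Proof.
have sub B y : (forall u, F u -> F (B *m u)) -> y \in L -> B *m y \in L.
  move=> FB /(min_face_span Kconv Kz)[u [v [Fu Fv ->]]].
  by rewrite mulmxBr memvB // mem_vspan //; exact: FB.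
split; last by apply: sub => u; rewrite aut_face.
have [uA _] := autA; rewrite -{2}[x](mulKmx uA); apply: sub => u Fu.
by apply/aut_face; rewrite aut_inv.
Qed.

(** All the cones of the theorem are sets of vectors of L, and A maps L onto
    itself. *)
Lemma aut_restrict (C : set (subvs_of L)) :
  (forall x y : subvs_of L, vsval y = A *m vsval x -> C y <-> C x) ->
  cone_aut_in L [set vsval x | x in C] A.
Proof.
move=> CA; split; apply/seteqP; split=> x /=.
- by move=> [y yL <-]; apply/aut_span.
- by move=> xL; exists (invmx A *m x); [apply/aut_span|]; rewrite aut_inv.
- move=> [_ [y Cy <-] <-].
  have yL : A *m vsval y \in L by apply/aut_span; exact: subvsP.
  exists (vsproj L (A *m vsval y)); last by rewrite vsprojK.
  by apply/(CA y) => //; rewrite vsprojK.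
- move=> [y Cy <-].
  have yL : invmx A *m vsval y \in L by apply/aut_span; rewrite aut_inv; exact: subvsP.
  exists (invmx A *m vsval y); last by rewrite aut_inv.
  exists (vsproj L (invmx A *m vsval y)); last by rewrite vsprojK.
  by apply/(CA _ y) => //; rewrite vsprojK // aut_inv.
Qed.

Let q : subvs_of L -> R := fun x => pm (vsval x).
Let zL : subvs_of L := vsproj L z.

Let zLE : vsval zL = z.
Proof. by rewrite vsprojK //; apply: mem_vspan; exact: min_face_id. Qed.

Lemma face_hyperbolic : hyperbolic (d - m) q zL.
Proof.
have h : hyperbolic (d - m) pm (vsval zL) by rewrite zLE; exact: hyperbolic_face_dir.
exact: (hyperbolic_comp (g := vsval) h).
Qed.

Lemma face_hypcone y : hypcone q zL y <-> F (vsval y).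
Proof.
rewrite /F (faceE he Kz) (_ : hypcone q zL y = hypcone pm z (vsval y)).
  by split=> [|[]//]; split=> //; exact: subvsP.
by apply/propext; split=> H t; have := H t; rewrite /q linearB linearZ /= zLE.
Qed.

Lemma face_hypconeE : F = [set vsval x | x in hypcone q zL].
Proof.
apply/seteqP; split=> x /=; last by move=> [y /face_hypcone Fy <-].
move=> Fx; have xL : x \in L by exact: mem_vspan.
by exists (vsproj L x); [apply/face_hypcone|]; rewrite vsprojK.
Qed.

(** This is rigidity for the map B that A induces on L. Extremal vectors of the
    face are extremal in the cone, as are their images under A, so p is affine
    along them. *)
Lemma face_derivative_cone k (x y : subvs_of L) : vsval y = A *m vsval x ->
  hypcone (dirderiv zL k q) zL y <-> hypcone (dirderiv zL k q) zL x.
Proof.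
pose B : {linear subvs_of L -> subvs_of L} := vsproj L \o (mulmx A \o vsval).
have BE u : vsval (B u) = A *m vsval u.
  by rewrite /B /= vsprojK //; apply/aut_span; exact: subvsP.
move=> yE; have -> : y = B x by apply: val_inj; rewrite /= BE.
have qpt : pointed_cone (hypcone q zL).
  apply/seteqP; split=> u /=; last first.
    by move=> ->; rewrite oppr0; split; exact: (hypcone0 face_hyperbolic).
  move=> [/face_hypcone Fu /face_hypcone FNu]; apply: val_inj.
  apply: (cone_opp Kpt); first exact: (min_face_sub Kconv Kz Fu).
  by rewrite -linearN; exact: (min_face_sub Kconv Kz FNu).
apply: (derivative_cone_invariant face_hyperbolic qpt eigenvalue_gt0).
- apply: val_inj; transitivity (A *m vsval zL); first exact: BE.
  have -> : val (a *: zL) = a *: vsval zL by exact: linearZ.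
  by rewrite zLE.
- by move=> u; rewrite !face_hypcone BE aut_face.
- move=> u [u0 /face_hypcone Fu Hu].
  have uE : extremal K (vsval u).
    apply: (extremal_face he Kz Fu); last first.
      apply: contra u0 => /eqP uz; apply/eqP/val_inj.
      by apply: (etrans uz); apply/esym; exact: (linear0 vsval).
    move=> v Fv Fuv; have vL : v \in L by exact: mem_vspan.
    have [||c vE] := Hu (vsproj L v).
    + by apply/face_hypcone; rewrite vsprojK.
    + by apply/face_hypcone; rewrite linearB /= vsprojK.
    + exists c; have := congr1 vsval vE; rewrite vsprojK // => ->.
  split=> w s; rewrite /q !linearD linearZ /= ?BE; apply: (dirderiv_affine he).
    exact: (ROG_extremal_affine he rog uE).
  exact: (ROG_extremal_affine he rog (aut_extremal uE)).
Qed.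

End Automorphism.

Theorem theorem3p19 (R : realType) (n d : nat) (p : 'cV[R]_n -> R)
    (e : 'cV[R]_n) (A : 'M[R]_n) :
  hyperbolic d p e ->
  regular_cone (hypcone p e) ->
  ROG d p e ->
  cone_aut (hypcone p e) A ->
  ((0 < n)%N -> exists z : 'cV[R]_n,
    hypcone p e z /\ eigenvector A z) /\
  forall z : 'cV[R]_n, hypcone p e z -> eigenvector A z ->
  let F := min_face (hypcone p e) z in
  let L := vspan F in
  let m := hypmult p e z in
  let q : subvs_of L -> R := fun x => dirderiv e m p (vsval x) in
  let zL : subvs_of L := vsproj L z in
  cone_aut_in L F A /\
  [/\ hyperbolic (d - m) q zL,
      F = [set vsval x | x in hypcone q zL]
    & (4 <= d - m)%N ->
      forall k : nat, (1 <= k <= d - m - 3)%N ->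
      cone_aut_in L [set vsval x | x in hypcone (dirderiv zL k q) zL] A].
Proof.
move=> he _ rog autA; split; first exact: (hyperbolic_eigenvector he rog autA).
move=> z Kz [z0 [a Az]] F L m q zL.
have FE : F = [set vsval x | x in hypcone q zL] := face_hypconeE he Kz.
have restrict := aut_restrict he rog autA Kz z0 Az.
split.
  rewrite [X in cone_aut_in _ X]FE; apply: restrict => x y yE.
  split=> /(face_hypcone he Kz) H; apply/(face_hypcone he Kz); move: H; rewrite yE.
    by move/(aut_face he rog autA Kz z0 Az).
  by move=> H; apply/(aut_face he rog autA Kz z0 Az).
split; [exact: (face_hyperbolic he Kz) | exact: FE | move=> _ k _].
by apply: restrict => x y; exact: (face_derivative_cone he rog autA Kz z0 Az).
Qed.
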